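(* Let $d\ge1$, $\alpha\in(0,2)$ and $\varepsilon>0$. For a function $V$ on $\mathbb R^d$ consider the super Poincaré inequality $$\text{(SP)}\quad\mu_V(f^2)\le r\,\mathscr E_{\alpha,V}(f,f)+\beta(r)\mu_V(|f|)^2,\quad r>0,\ f\in\mathscr D(\mathscr E_{\alpha,V}).$$ (1) Let $V(x)=\log^{1+\varepsilon}(1+|x|^2)$. Then there exists a constant $c>0$ such that (SP) holds for $$\beta(r)=c+c\,r^{-2(\alpha+d)/\alpha}\exp\big[c\log^{1/(1+\varepsilon)}(1+r^{-1})\big],\quad r>0.$$ Consequently, there exists a constant $\lambda>0$ such that $$\|P_t^{\alpha,V}\|_{L^1(\mu_V)\to L^\infty(\mu_V)}\le\lambda+\lambda\,t^{-2(\alpha+d)/\alpha}\exp\big[\lambda\log^{1/(1+\varepsilon)}(1+t^{-1})\big],\quad t>0.$$ (2) Let $V(x)=(1+|x|^2)^\varepsilon$. Then there exists a constant $c>0$ such that (SP) holds for $$\beta(r)=c\Big(1+r^{-2(\alpha+d)/\alpha}\log^{(2\alpha+d)(d+\alpha)/(2\varepsilon\alpha)}(1+r^{-1})\Big),\quad r>0,$$ and consequently, $$\|P_t^{\alpha,V}\|_{L^1(\mu_V)\to L^\infty(\mu_V)}\le\lambda\Big(1+t^{-2(\alpha+d)/\alpha}\log^{(2\alpha+d)(d+\alpha)/(2\varepsilon\alpha)}(1+t^{-1})\Big),\quad t>0,$$ holds for some constant $\lambda>0$.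
   Context: $\mu_V(dx):=\big(\int_{\mathbb R^d}e^{-V(y)}dy\big)^{-1}e^{-V(x)}dx$ is a probability measure; $\mu_V(f):=\int f\,d\mu_V$. The Dirichlet form is $$\mathscr E_{\alpha,V}(f,g):=\iint_{\mathbb R^d\times\mathbb R^d}\frac{(f(x)-f(y))(g(x)-g(y))}{|x-y|^{d+\alpha}}\,dy\,\mu_V(dx),\qquad \mathscr D(\mathscr E_{\alpha,V}):=\{f\in L^2(\mu_V):\mathscr E_{\alpha,V}(f,f)<\infty\},$$ a symmetric Dirichlet form on $L^2(\mu_V)$, and $P_t^{\alpha,V}$ is the associated Markov semigroup. $\|\cdot\|_{L^p(\mu_V)\to L^q(\mu_V)}$ is the operator norm. $\log^{s}(u)$ means $(\log u)^s$. *)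

(* Defs.v *)
From HB Require Import structures.
From mathcomp Require Import all_boot all_order all_algebra.
From mathcomp Require Import all_classical all_reals all_analysis.
From mathcomp Require Import measurable_realfun.

Set Implicit Arguments.
Unset Strict Implicit.
Unset Printing Implicit Defensive.
Import Order.TTheory GRing.Theory Num.Theory.
Import numFieldNormedType.Exports.

Local Open Scope classical_set_scope.
Local Open Scope ring_scope.

(* Lebesgue measure on R^d, with R^d encoded as d-tuples (carrying the product
   sigma-algebra): the image of the iterated product measure under
   (a, x) |-> a :: x.  See [lebesgue_tuple_box]. *)

Section cons_measure.
Context {R : realType} (n : nat).
Variable m : {sigma_finite_measure set (n.-tuple (measurableTypeR R)) -> \bar R}.
Local Open Scope ereal_scope.

Definition tcons (z : measurableTypeR R * n.-tuple (measurableTypeR R)) :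
  n.+1.-tuple (measurableTypeR R) := [tuple of z.1 :: z.2].

Lemma measurable_tcons : measurable_fun setT tcons.
Proof. exact: measurable_cons. Qed.

Definition cons_measure : set (n.+1.-tuple (measurableTypeR R)) -> \bar R :=
  pushforward (@lebesgue_measure R \x m) tcons.

Let cons_measure0 : cons_measure set0 = 0.
Proof. by rewrite /cons_measure /pushforward preimage_set0 measure0. Qed.

Let cons_measure_ge0 A : 0 <= cons_measure A.
Proof. by rewrite /cons_measure /pushforward; exact: measure_ge0. Qed.

Let cons_measure_sigma_additive : semi_sigma_additive cons_measure.
Proof.
move=> F mF tF mUF; rewrite /cons_measure /pushforward preimage_bigcup.
have mt A : measurable A -> measurable (tcons @^-1` A).
  by move=> mA; rewrite -[X in measurable X]setTI; exact: measurable_tcons.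
apply: measure_semi_sigma_additive.
- by move=> k; exact: mt.
- apply/trivIsetP => /= i j _ _ ij; rewrite -preimage_setI.
  by move/trivIsetP : tF => /(_ _ _ _ _ ij) ->//; rewrite preimage_set0.
- by rewrite -preimage_bigcup; exact: mt.
Qed.

HB.instance Definition _ := isMeasure.Build _ _ _ cons_measure
  cons_measure0 cons_measure_ge0 cons_measure_sigma_additive.

Lemma cons_measureE (A : set (measurableTypeR R))
    (B : set (n.-tuple (measurableTypeR R))) :
  measurable A -> measurable B ->
  cons_measure [set x | A (thead x) /\ B [tuple of behead x]] =
    lebesgue_measure A * m B.
Proof.
move=> mA mB; rewrite -product_measure1E// /cons_measure /pushforward.
congr (_ _); apply/seteqP; split=> -[a x] /=; rewrite theadE;
  (have -> : [tuple of behead (tcons (a, x))] = x by exact/val_inj); by [].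
Qed.

Let cons_measure_sigma_finite : sigma_finite setT cons_measure.
Proof.
have /sigma_finiteP[F [TF ndF Foo]] := sigma_finiteT (@lebesgue_measure R).
have /sigma_finiteP[G [TG ndG Goo]] := sigma_finiteT m.
exists (fun k => [set x | F k (thead x) /\ G k [tuple of behead x]]).
  rewrite predeqE => x; split=> // _.
  have [i _ Fi] : (\bigcup_i F i) (thead x) by rewrite -TF.
  have [j _ Gj] : (\bigcup_i G i) [tuple of behead x] by rewrite -TG.
  exists (maxn i j) => //; split.
  - by move: Fi; exact/subsetPset/ndF/leq_maxl.
  - by move: Gj; exact/subsetPset/ndG/leq_maxr.
move=> k; have [mF Fk] := Foo k; have [mG Gk] := Goo k; split.
  apply: measurableI.
  - by rewrite -[X in measurable X]setTI; exact: measurable_tnth.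
  - by rewrite -[X in measurable X]setTI; exact: measurable_behead.
by rewrite cons_measureE// lte_mul_pinfty// ge0_fin_numE.
Qed.

HB.instance Definition _ := Measure_isSigmaFinite.Build _ _ _ cons_measure
  cons_measure_sigma_finite.

End cons_measure.

Fixpoint lebesgue_tuple {R : realType} (n : nat) :
    {sigma_finite_measure set (n.-tuple (measurableTypeR R)) -> \bar R} :=
  match n with
  | 0 => dirac [tuple]
  | k.+1 => cons_measure (lebesgue_tuple k)
  end.

Lemma lebesgue_tuple_box {R : realType} (n : nat)
    (A : 'I_n -> set (measurableTypeR R)) :
  (forall i, measurable (A i)) ->
  lebesgue_tuple n [set x | forall i, A i (tnth x i)] =
    (\prod_(i < n) lebesgue_measure (A i))%E.
Proof.
elim: n A => [|n IHn] A mA.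
  rewrite big_ord0 /= diracE (_ : _ \in _) ?inE//.
  by move=> /= [].
have mB : measurable [set x : n.-tuple (measurableTypeR R) |
    forall i, A (lift ord0 i) (tnth x i)].
  rewrite (_ : [set _ | _] =
    \bigcap_(i in [set: 'I_n]) ((@tnth n _)^~ i @^-1` A (lift ord0 i))).
    apply: fin_bigcap_measurable => // i _.
    by rewrite -[X in measurable X]setTI; exact: measurable_tnth.
  by apply/seteqP; split=> x /= Ax i; [move=> _; exact: Ax|exact: Ax].
rewrite big_ord_recl -IHn// -cons_measureE//=.
congr (cons_measure _ _); apply/seteqP; split => x /= Ax.
  split=> [|i]; first exact: Ax.
  have := Ax (lift ord0 i); rewrite {1}(tuple_eta x) tnthS.
  by congr (A _ _); congr tnth; exact/val_inj.
move=> i; case: (unliftP ord0 i) => [j ->|->]; last exact: Ax.1.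
have := Ax.2 j; rewrite [in X in _ -> X](tuple_eta x) tnthS.
by congr (A _ _); congr tnth; exact/val_inj.
Qed.

Notation euclidean R d := (d.-tuple (measurableTypeR R)).

Section euclidean_norm.
Context {R : realType} (d : nat).

Definition enorm (x : euclidean R d) : R :=
  Num.sqrt (\sum_(i < d) (tnth x i : R) ^+ 2).

Definition edist (x y : euclidean R d) : R :=
  Num.sqrt (\sum_(i < d) ((tnth x i : R) - (tnth y i : R)) ^+ 2).

Lemma measurable_enorm : measurable_fun setT enorm.
Proof.
apply: (@measurableT_comp _ _ _ _ _ _ (@Num.sqrt R)).
  by apply: continuous_measurable_fun; exact: sqrt_continuous.
apply: measurable_sum => i; apply: measurable_funX.
exact: measurable_tnth.
Qed.

End euclidean_norm.

Section gibbs_measure.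
Context {R : realType} (d : nat).
Variable V : {mfun euclidean R d >-> R}.
Local Open Scope ereal_scope.

Definition partition_function : \bar R :=
  \int[lebesgue_tuple d]_x (expR (- V x))%:E.

(* As [fine +oo = 0], this is the zero measure when e^-V is not integrable. *)
Definition gibbs (A : set (euclidean R d)) : \bar R :=
  (fine partition_function)^-1%:E *
  \int[lebesgue_tuple d]_(x in A) (expR (- V x))%:E.

Let mexpNV : measurable_fun setT (fun x => (expR (- V x))%:E).
Proof.
apply/measurable_EFinP; apply: measurableT_comp => //.
exact: measurable_funN.
Qed.

Let partition_function_ge0 : 0 <= partition_function.
Proof. by apply: integral_ge0 => x _; rewrite lee_fin expR_ge0. Qed.

Let gibbs0 : gibbs set0 = 0.
Proof. by rewrite /gibbs integral_set0 mule0. Qed.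

Let gibbs_ge0 A : 0 <= gibbs A.
Proof.
rewrite /gibbs mule_ge0//.
- by rewrite lee_fin invr_ge0 fine_ge0.
- by apply: integral_ge0 => x _; rewrite lee_fin expR_ge0.
Qed.

Let gibbs_sigma_additive : semi_sigma_additive gibbs.
Proof.
move=> F mF tF mUF.
rewrite [X in _ --> X](_ : _ = \sum_(k <oo) gibbs (F k)).
  by apply: is_cvg_nneseries => k _ _; exact: gibbs_ge0.
rewrite /gibbs.
have -> : \int[lebesgue_tuple d]_(x in \bigcup_k F k) (expR (- V x))%:E =
    \sum_(k <oo) \int[lebesgue_tuple d]_(x in F k) (expR (- V x))%:E.
  by apply: ge0_integral_bigcup => //; exact: measurable_funTS.
rewrite nneseriesZl => [//|k _].
by apply: integral_ge0 => x _; rewrite lee_fin expR_ge0.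
Qed.

HB.instance Definition _ := isMeasure.Build _ _ _ gibbs
  gibbs0 gibbs_ge0 gibbs_sigma_additive.

Let gibbs_fin : fin_num_fun gibbs.
Proof.
move=> A mA; rewrite /gibbs.
have le_part : \int[lebesgue_tuple d]_(x in A) (expR (- V x))%:E
    <= partition_function.
  by apply: ge0_subset_integral => // x _; rewrite lee_fin expR_ge0.
have : 0 <= \int[lebesgue_tuple d]_(x in A) (expR (- V x))%:E.
  by apply: integral_ge0 => x _; rewrite lee_fin expR_ge0.
move: le_part partition_function_ge0.
case: partition_function => [z| |] //= Az _ A0.
  by rewrite fin_numM// ge0_fin_numE// (le_lt_trans Az)// ltry.
by rewrite invr0 mul0e.
Qed.

HB.instance Definition _ := Measure_isFinite.Build _ _ _ gibbs gibbs_fin.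

Lemma gibbs_setT : 0 < partition_function < +oo -> gibbs setT = 1.
Proof.
have -> : gibbs setT = (fine partition_function)^-1%:E * partition_function.
  by [].
case: partition_function => [z| |]; rewrite ?ltxx ?andbF //=.
by rewrite lte_fin => /andP[z0 _]; rewrite -EFinM mulVf ?gt_eqF.
Qed.

End gibbs_measure.

Section dirichlet_form.
Context {R : realType} (d : nat).
Variables (alpha : R) (V : {mfun euclidean R d >-> R}).
Implicit Types f g : euclidean R d -> R.
Local Open Scope ereal_scope.

Definition dirichlet_form f g : \bar R :=
  \int[gibbs V \x lebesgue_tuple d]_z
    ((f z.1 - f z.2) * (g z.1 - g z.2) /
      edist z.1 z.2 `^ (d%:R + alpha))%:E.

Definition dirichlet_dom : set (euclidean R d -> R) :=
  [set f | f \in Lfun (gibbs V) 2%:E /\ dirichlet_form f f < +oo].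

Definition super_poincare (beta : R -> R) : Prop :=
  forall r, (0 < r)%R -> forall f, dirichlet_dom f ->
    \int[gibbs V]_x (f x ^+ 2)%:E <=
      r%:E * dirichlet_form f f +
      (beta r)%:E * (\int[gibbs V]_x `|f x|%:E) ^+ 2.

End dirichlet_form.

Section markov_semigroup.
Context {disp : measure_display} {T : measurableType disp} {R : realType}.
Variable mu : {measure set T -> \bar R}.
Implicit Types f g h : T -> R.

Definition L2norm f : \bar R := 'N[mu]_2%:E[EFin \o f]%E.

(* Elements of L^2(mu) are handled through representatives: every law below
   holds mu-almost everywhere, and [P t] respects mu-a.e. equality. *)
Record markov_semigroup (P : R -> (T -> R) -> (T -> R)) : Prop := {
  semigroup_L2 : forall t, 0 <= t ->
    {in Lfun mu 2%:E, forall f, P t f \in Lfun mu 2%:E} ;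
  semigroup_ae_eq : forall t, 0 <= t ->
    {in Lfun mu 2%:E &, forall f g,
      f = g %[ae mu] -> P t f = P t g %[ae mu]} ;
  semigroup_linear : forall t (a : R), 0 <= t ->
    {in Lfun mu 2%:E &, forall f g,
      P t (fun x => a * f x + g x) = (fun x => a * P t f x + P t g x)
        %[ae mu]} ;
  semigroup0 : {in Lfun mu 2%:E, forall f, P 0 f = f %[ae mu]} ;
  semigroupD : forall s t, 0 <= s -> 0 <= t ->
    {in Lfun mu 2%:E, forall f, P (s + t) f = P s (P t f) %[ae mu]} ;
  semigroup_contraction : forall t, 0 <= t ->
    {in Lfun mu 2%:E, forall f, (L2norm (P t f) <= L2norm f)%E} ;
  semigroup_continuous : {in Lfun mu 2%:E, forall f,
    L2norm (P t f \- f) @[t --> 0^'+] --> 0%E} ;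
  semigroup_symmetric : forall t, 0 <= t ->
    {in Lfun mu 2%:E &, forall f g,
      (\int[mu]_x (P t f x * g x)%:E = \int[mu]_x (f x * P t g x)%:E)%E} ;
  semigroup_markov : forall t, 0 <= t ->
    {in Lfun mu 2%:E, forall f,
      (\forall x \ae mu, 0 <= f x <= 1) ->
      (\forall x \ae mu, 0 <= P t f x <= 1)}
}.

(* (f, h) is in the graph of the L^2-generator of P. *)
Definition generator (P : R -> (T -> R) -> (T -> R)) f h : Prop :=
  [/\ f \in Lfun mu 2%:E, h \in Lfun mu 2%:E &
    L2norm (fun x => t^-1 * (P t f x - f x) - h x) @[t --> 0^'+] --> 0%E].

(* The operator norm L^p -> L^q of an operator given on L^2; the supremum is
   over L^p `&` L^2, which is dense in L^p for 1 <= p < +oo and mu finite. *)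
Definition opnorm (p q : \bar R) (S : (T -> R) -> (T -> R)) : \bar R :=
  ereal_sup [set 'N[mu]_q[EFin \o S f]%E | f in
    [set f | f \in Lfun mu 2%:E /\ ('N[mu]_p[EFin \o f] <= 1)%E]].

End markov_semigroup.

(* The generator L of P is the self-adjoint operator of the form E:
   f is in D(L) and L f = h iff f is in D(E) and
   E(f, g) = - mu(h g) for all g in D(E). *)
Definition form_semigroup {R : realType} (d : nat) (alpha : R)
    (V : {mfun euclidean R d >-> R})
    (P : R -> (euclidean R d -> R) -> (euclidean R d -> R)) : Prop :=
  markov_semigroup (gibbs V) P /\
  forall f h, f \in Lfun (gibbs V) 2%:E -> h \in Lfun (gibbs V) 2%:E ->
    (generator (gibbs V) P f h <->
     dirichlet_dom alpha V f /\
     forall g, dirichlet_dom alpha V g ->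
       (dirichlet_form alpha V f g = - \int[gibbs V]_x (h x * g x)%:E)%E).

Section potentials.
Context {R : realType} (d : nat) (eps : R).

Definition log_potential (x : euclidean R d) : R :=
  ln (1 + enorm x ^+ 2) `^ (1 + eps).

Definition power_potential (x : euclidean R d) : R :=
  (1 + enorm x ^+ 2) `^ eps.

Let menorm2 : measurable_fun setT (fun x : euclidean R d => 1 + enorm x ^+ 2).
Proof.
apply: measurable_funD => //; apply: measurable_funX.
exact: measurable_enorm.
Qed.

Let mlog_potential : measurable_fun setT log_potential.
Proof.
apply: (@measurableT_comp _ _ _ _ _ _ (@powR R ^~ (1 + eps))) => //.
exact: (measurableT_comp (@measurable_ln R) menorm2).
Qed.

HB.instance Definition _ :=
  isMeasurableFun.Build _ _ _ _ log_potential mlog_potential.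

Let mpower_potential : measurable_fun setT power_potential.
Proof. exact: (@measurableT_comp _ _ _ _ _ _ (@powR R ^~ eps)). Qed.

HB.instance Definition _ :=
  isMeasurableFun.Build _ _ _ _ power_potential mpower_potential.

End potentials.

Section rates.
Context {R : realType} (d : nat) (alpha eps : R).

Definition log_rate (c r : R) : R :=
  c + c * r `^ (- (2 * (alpha + d%:R) / alpha)) *
    expR (c * ln (1 + r^-1) `^ (1 / (1 + eps))).

Definition power_rate (c r : R) : R :=
  c * (1 + r `^ (- (2 * (alpha + d%:R) / alpha)) *
    ln (1 + r^-1) `^
      ((2 * alpha + d%:R) * (d%:R + alpha) / (2 * eps * alpha))).

End rates.

(* Main.v *)
From mathcomp Require Import all_boot all_order all_algebra.
From mathcomp Require Import ring lra.
From mathcomp Require Import all_classical all_reals all_analysis.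
From mathcomp Require Import measurable_realfun ess_sup_inf.
(* After mathcomp-analysis, whose own [edist] would otherwise shadow the
   Euclidean distance. *)
Require Import Defs.

Set Implicit Arguments.
Unset Strict Implicit.
Unset Printing Implicit Defensive.
Import Order.TTheory GRing.Theory Num.Theory.
Import numFieldNormedType.Exports.
Local Open Scope classical_set_scope.
Local Open Scope ring_scope.

(** Both rates dominate a multiple of [1 + r^-q] with [q = 2 (alpha + d) / alpha],
    so it is enough to use that simpler rate.

    Super Poincare inequality.  Integrate [f(x)^2 <= (f(x) - f(y))^2 + 2 |f(x) f(y)|]
    over [y].  For [x] in the sublevel set [V <= L], let [y] range over a cube of
    radius [s] around [x]: the first term costs at most [s^alpha] times the form,
    the second one the square of the L^1 norm times [s^-d] and the maximum of
    [e^V] near the sublevel set.  For [V(x) > L], let [y] range over a fixed cube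
    around the origin: writing the form as an integral against
    [e^(V(x) - V(y)) dy mu(dx)] after exchanging [x] and [y], the first term costs
    [|x|^(d + alpha) e^(-V(x))], which is of order [e^(-L/2)] since [e^V] grows
    faster than every power.  Take [e^(-L/2) = r] and [s] of order
    [r^(1/alpha)]; the resulting exponent of [r] is better than [- q].

    Ultracontractivity.  For [g] in the domain of the generator [A], convexity of
    [t |-> <P_t g, g>] gives [- 2 t <A P_t g, P_t g> <= |g|^2], hence
    [|P_t g|_2^2 <= r / (2 t) |g|_2^2 + beta(r) |g|_1^2]; by density this holds
    for every [g] in L^2.  With [r] a small multiple of [t], iterating along [t / 2^n]
    absorbs the first term and bounds [P_t] from L^1 to L^2; symmetry and the
    semigroup law then give the bound from L^1 to L^oo. *)

(** * Contraction semigroups on a semi-inner product space *)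

(** Only semi-definite, because the vectors will be functions rather than classes modulo null sets:
    a nonzero vector may have norm 0. *)
Record semi_inner {R : realType} {V : lmodType R} (ip : V -> V -> R) : Prop := {
  semi_inner_sym : forall x y, ip x y = ip y x ;
  semi_inner_linear : forall a x y z, ip (a *: x + y) z = a * ip x z + ip y z ;
  semi_inner_ge0 : forall x, 0 <= ip x x }.

Definition snorm {R : realType} {V : lmodType R} (ip : V -> V -> R) (x : V) : R :=
  Num.sqrt (ip x x).

Section semi_inner_theory.
Context {R : realType} {V : lmodType R} (ip : V -> V -> R).
Context (ipP : semi_inner ip).
Local Notation nr := (snorm ip).

Lemma ipDl x y z : ip (x + y) z = ip x z + ip y z.
Proof. by rewrite -[x in x + y]scale1r (semi_inner_linear ipP) mul1r. Qed.

Lemma ip0l z : ip 0 z = 0.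
Proof. by apply: (addrI (ip 0 z)); rewrite -ipDl !addr0. Qed.

Lemma ipZl a x z : ip (a *: x) z = a * ip x z.
Proof. by rewrite -[a *: x]addr0 (semi_inner_linear ipP) ip0l addr0. Qed.

Lemma ipNl x z : ip (- x) z = - ip x z.
Proof. by rewrite -scaleN1r ipZl mulN1r. Qed.

Lemma ipBl x y z : ip (x - y) z = ip x z - ip y z.
Proof. by rewrite ipDl ipNl. Qed.

Lemma ipDr x y z : ip z (x + y) = ip z x + ip z y.
Proof. by rewrite (semi_inner_sym ipP) ipDl !(semi_inner_sym ipP z). Qed.

Lemma ipZr a x z : ip z (a *: x) = a * ip z x.
Proof. by rewrite (semi_inner_sym ipP) ipZl (semi_inner_sym ipP z). Qed.

Lemma ipNr x z : ip z (- x) = - ip z x.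
Proof. by rewrite -scaleN1r ipZr mulN1r. Qed.

Lemma ipBr x y z : ip z (x - y) = ip z x - ip z y.
Proof. by rewrite ipDr ipNr. Qed.

Lemma sqr_snorm x : nr x ^+ 2 = ip x x.
Proof. by rewrite sqr_sqrtr// (semi_inner_ge0 ipP). Qed.

Lemma snorm_ge0 x : 0 <= nr x.
Proof. exact: sqrtr_ge0. Qed.

Lemma ip_sqr_le x y : ip x y ^+ 2 <= ip x x * ip y y.
Proof.
have quad a : 0 <= ip x x - 2 * a * ip x y + a ^+ 2 * ip y y.
  have := semi_inner_ge0 ipP (x - a *: y).
  rewrite ipBl !ipBr !ipZl !ipZr (semi_inner_sym ipP y x).
  by congr (0 <= _); ring.
have [y0|] := eqVneq (ip y y) 0; last first.
  move=> yN0; have y_gt0 : 0 < ip y y by rewrite lt0r yN0 (semi_inner_ge0 ipP).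
  rewrite -subr_ge0 (_ : _ - _ = ip y y * (ip x x - 2 * (ip x y / ip y y) * ip x y +
    (ip x y / ip y y) ^+ 2 * ip y y)); last by field.
  by rewrite pmulr_rge0.
rewrite y0 mulr0; have [->|xyN0] := eqVneq (ip x y) 0; first by rewrite expr0n.
(* For [ip y y = 0] the quadratic is affine in [a]; at this value of [a] it equals -1, a
   contradiction. *)
have := quad ((ip x x + 1) / (2 * ip x y)).
rewrite y0 (_ : _ + _ = -1); last by field.
by rewrite ler0N1.
Qed.

Lemma ip_le x y : ip x y <= nr x * nr y.
Proof.
rewrite -sqrtrM ?(semi_inner_ge0 ipP)//.
by rewrite (le_trans (ler_norm _))// -sqrtr_sqr ler_sqrt ?ip_sqr_le// mulr_ge0//
  (semi_inner_ge0 ipP).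
Qed.

Lemma snorm0 : nr 0 = 0.
Proof. by rewrite /snorm ip0l sqrtr0. Qed.

Lemma snormN x : nr (- x) = nr x.
Proof. by rewrite /snorm ipNl ipNr opprK. Qed.

Lemma ip_abs_le x y : `|ip x y| <= nr x * nr y.
Proof.
by rewrite ler_norml ip_le andbT lerNl -ipNl -(snormN x) ip_le.
Qed.

Lemma ler_snormD x y : nr (x + y) <= nr x + nr y.
Proof.
rewrite -[leRHS]ger0_norm ?addr_ge0 ?snorm_ge0// -sqrtr_sqr.
rewrite ler_sqrt ?sqr_ge0// ipDl !ipDr (semi_inner_sym ipP y x) sqrrD !sqr_snorm.
by have := ip_le x y; lra.
Qed.

Lemma ler_snormB x y : nr (x - y) <= nr x + nr y.
Proof. by rewrite (le_trans (ler_snormD _ _))// snormN. Qed.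

Lemma snorm_sub_le x y : nr x - nr y <= nr (x - y).
Proof. by rewrite lerBlDr (le_trans _ (ler_snormD _ _))// subrK. Qed.

Lemma snormC x y : nr (x - y) = nr (y - x).
Proof. by rewrite -snormN opprB. Qed.

Lemma snormZ a x : nr (a *: x) = `|a| * nr x.
Proof.
by rewrite /snorm ipZl ipZr mulrA -expr2 sqrtrM ?sqr_ge0// sqrtr_sqr.
Qed.

(* Operators are only determined up to null vectors, so identities between
   them are stated after pairing with an arbitrary vector. *)
Lemma eq_snorm x y : (forall z, ip x z = ip y z) -> nr x = nr y.
Proof.
by move=> xy; rewrite /snorm xy (semi_inner_sym ipP) xy.
Qed.

End semi_inner_theory.

(** Equations are tested against an arbitrary [z], since they hold only up to null vectors. Laws
    without a sign condition on [t] hold for all real [t], because the L^2 semigroup will be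
    extended to negative times through |t|. *)
Record contraction_semigroup {R : realType} {V : lmodType R} (ip : V -> V -> R)
    (P : R -> V -> V) : Prop := {
  csg_linear : forall t a x y z,
    ip (P t (a *: x + y)) z = a * ip (P t x) z + ip (P t y) z ;
  csg_0 : forall x z, ip (P 0 x) z = ip x z ;
  csg_D : forall s t x z, 0 <= s -> 0 <= t ->
    ip (P (s + t) x) z = ip (P s (P t x)) z ;
  csg_contraction : forall t x, ip (P t x) (P t x) <= ip x x ;
  csg_sym : forall t x y, ip (P t x) y = ip x (P t y) ;
  csg_continuous : forall x e, 0 < e -> exists2 a, 0 < a &
    forall t, 0 < t < a -> snorm ip (P t x - x) <= e }.

(** The strong right derivative at 0 of the orbit of [g] is [k], up to null vectors. *)
Definition in_generator {R : realType} {V : lmodType R} (ip : V -> V -> R)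
    (P : R -> V -> V) (g k : V) : Prop :=
  forall e, 0 < e -> exists2 a, 0 < a &
    forall s, 0 < s < a -> snorm ip (s^-1 *: (P s g - g) - k) <= e.

Section semigroup_theory.
Context {R : realType} {V : lmodType R} (ip : V -> V -> R).
Context (ipP : semi_inner ip) (P : R -> V -> V).
Context (PP : contraction_semigroup ip P).
Local Notation nr := (snorm ip).

Lemma csgD t x y z : ip (P t (x + y)) z = ip (P t x) z + ip (P t y) z.
Proof. by rewrite -[x in x + y]scale1r (csg_linear PP) mul1r. Qed.

Lemma csg_zero t z : ip (P t 0) z = 0.
Proof. by apply: (addrI (ip (P t 0) z)); rewrite -csgD !addr0. Qed.

Lemma csgZ t a x z : ip (P t (a *: x)) z = a * ip (P t x) z.
Proof. by rewrite -[a *: x]addr0 (csg_linear PP) csg_zero addr0. Qed.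

Lemma csgB t x y z : ip (P t (x - y)) z = ip (P t x) z - ip (P t y) z.
Proof. by rewrite csgD -scaleN1r csgZ mulN1r. Qed.

Lemma csg_snorm t x : nr (P t x) <= nr x.
Proof. by rewrite ler_sqrt ?(semi_inner_ge0 ipP)// (csg_contraction PP). Qed.

Lemma csg_mul s t x y : 0 <= s -> 0 <= t ->
  ip (P s x) (P t y) = ip (P (s + t) x) y.
Proof. by move=> s0 t0; rewrite addrC (csg_D PP)// (csg_sym PP t). Qed.

Lemma csg_continuous0 x e : 0 < e -> exists2 a, 0 < a &
  forall t, 0 <= t <= a -> nr (P t x - x) <= e.
Proof.
move=> e0; have [a a0 aP] := csg_continuous PP x e0.
exists (a / 2); first by rewrite divr_gt0.
move=> t /andP[]; rewrite le_eqVlt => /predU1P[<- _|t0 ta].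
  rewrite (eq_snorm ipP (y := 0)); first by rewrite (snorm0 ipP) ltW.
  by move=> z; rewrite (ipBl ipP) (csg_0 PP) (ip0l ipP) subrr.
by apply: aP; rewrite t0/=; lra.
Qed.

(** * Dyadic Riemann sums along an orbit *)

Section dyadic_average.
Context (f : V) (h : R).
Hypothesis h0 : 0 < h.
Local Notation dl n := (h / 2 ^+ n).

(* The Riemann sum [2^-n * \sum_(k < 2^n) P (k h / 2^n) f], as a product of
   two-point averages. *)
Fixpoint davg n : V :=
  if n is m.+1 then 2^-1 *: (davg m + P (h / 2 ^+ n) (davg m)) else f.

Let dl_gt0 n : 0 < dl n.
Proof. by rewrite divr_gt0// exprn_gt0. Qed.

Let dlS n : dl n = dl n.+1 + dl n.+1.
Proof. by rewrite exprS; field; rewrite expf_neq0. Qed.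

(** With [u] the new step, (P_u - 1)(P_u + 1) = P_2u - 1, so each halving of the step contributes a
    factor 1/2. *)
Lemma davg_telescope n z :
  ip (P (dl n) (davg n) - davg n) z = 2 ^- n * ip (P h f - f) z.
Proof.
elim: n z => [|n IHn] z; first by rewrite /= expr0 divr1 invr1 mul1r.
rewrite [davg n.+1]/= (ipBl ipP) csgZ csgD (ipZl ipP) (ipDl ipP).
rewrite -(csg_D PP) ?(ltW (dl_gt0 _))// -dlS.
have := IHn z; rewrite (ipBl ipP) => {}IHn.
rewrite exprS invfM -mulrA -IHn; ring.
Qed.

(** The average is made of contractions that commute with [P t], so it inherits the modulus of
    continuity of [f] at 0, uniformly in [n]. *)
Lemma davg_modulus n t : 0 <= t -> nr (P t (davg n) - davg n) <= nr (P t f - f).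
Proof.
move=> t0; elim: n => [//|n]; apply: le_trans.
have -> : nr (P t (davg n.+1) - davg n.+1) =
    nr (2^-1 *: (P t (davg n) - davg n + P (dl n.+1) (P t (davg n) - davg n))).
  apply: (eq_snorm ipP) => z.
  rewrite [davg n.+1]/= (ipBl ipP) csgZ !(ipZl ipP) csgD !(ipDl ipP) csgB (ipNl ipP).
  by rewrite -!(csg_D PP) ?(ltW (dl_gt0 _))// [t + _]addrC; ring.
rewrite (snormZ ipP) ger0_norm ?invr_ge0//.
have := ler_snormD ipP (P t (davg n) - davg n) (P (dl n.+1) (P t (davg n) - davg n)).
have := csg_snorm (dl n.+1) (P t (davg n) - davg n).
by lra.
Qed.

Lemma davg_cauchy n m e : (n <= m)%N ->
  (forall t, 0 <= t <= dl n -> nr (P t f - f) <= e) ->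
  nr (davg m - davg n) <= e.
Proof.
move=> nm fe.
(* The induction needs all times [t] up to the current step: the next average evaluates the orbit at
   [t] and at [t] plus the new step, and both stay within the previous step. *)
suff H : forall t, 0 <= t <= dl m -> nr (P t (davg m) - davg n) <= e.
  rewrite (_ : nr _ = nr (P 0 (davg m) - davg n)).
    by apply: H; rewrite lexx ltW.
  by apply: (eq_snorm ipP) => z; rewrite !(ipBl ipP) (csg_0 PP).
rewrite -(subnK nm); elim: (m - n)%N => [|k IHk] t /andP[t0 tk].
  by rewrite add0n (le_trans (davg_modulus _ _))// fe// t0.
rewrite addSn in tk *.
have -> : nr (P t (davg (k + n).+1) - davg n) =
    nr (2^-1 *: ((P t (davg (k + n)) - davg n) +
       (P (t + dl (k + n).+1) (davg (k + n)) - davg n))).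
  apply: (eq_snorm ipP) => z.
  rewrite [davg _.+1]/= (ipBl ipP) csgZ !(ipZl ipP) csgD !(ipDl ipP) (ipNl ipP).
  by rewrite -!(csg_D PP) ?(ltW (dl_gt0 _))//; field.
rewrite (snormZ ipP) ger0_norm ?invr_ge0//.
have := ler_snormD ipP (P t (davg (k + n)) - davg n)
  (P (t + dl (k + n).+1) (davg (k + n)) - davg n).
have tk2 : 0 <= t <= dl (k + n) by rewrite t0 dlS (le_trans tk)// lerDl ltW.
have tk3 : 0 <= t + dl (k + n).+1 <= dl (k + n).
  by rewrite addr_ge0 ?(ltW (dl_gt0 _))//= (dlS (k + n)) lerD2r.
by have := IHk _ tk2; have := IHk _ tk3; lra.
Qed.

(** Applying the telescoping identity at the first [j] grid points writes the increment as 2^-n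
    times the sum of the P (i h / 2^n) w, where w = P h f - f. Replacing each term by w costs at
    most [e]. *)
Lemma davg_increment n j e :
  (forall i, (i < j)%N -> nr (P (i%:R * dl n) (P h f - f) - (P h f - f)) <= e) ->
  nr (P (j%:R * dl n) (davg n) - davg n - (j%:R * 2 ^- n) *: (P h f - f)) <=
    j%:R * 2 ^- n * e.
Proof.
elim: j => [|j IHj] je.
  rewrite !mul0r scale0r subr0 (_ : snorm _ _ = nr 0).
    by rewrite /snorm (ip0l ipP) sqrtr0.
  by apply: (eq_snorm ipP) => z; rewrite (ipBl ipP) (csg_0 PP) (ip0l ipP) subrr.
have {}IHj := IHj (fun i ij => je i (leqW ij)).
have tel := davg_telescope n.
set w := P h f - f in tel je IHj *; clearbody w.
have -> : nr (P (j.+1%:R * dl n) (davg n) - davg n - (j.+1%:R * 2 ^- n) *: w) =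
    nr ((P (j%:R * dl n) (davg n) - davg n - (j%:R * 2 ^- n) *: w) +
       2 ^- n *: (P (j%:R * dl n) w - w)).
  apply: (eq_snorm ipP) => z.
  rewrite -natr1 mulrDl mul1r !(ipDl ipP) !(ipZl ipP) !(ipNl ipP) !(ipZl ipP).
  rewrite (csg_D PP) ?(ltW (dl_gt0 _))//; last first.
    by rewrite mulr_ge0// (ltW (dl_gt0 _)).
  rewrite !(ipDl ipP) !(ipNl ipP).
  have := tel (P (j%:R * dl n) z).
  rewrite (ipBl ipP) -!(csg_sym PP) => H.
  by rewrite -[ip (P _ (P _ _)) z](subrK (ip (P (j%:R * dl n) (davg n)) z)) H; ring.
rewrite (le_trans (ler_snormD ipP _ _))//.
have -> : j.+1%:R * 2 ^- n * e = j%:R * 2 ^- n * e + 2 ^- n * e.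
  by rewrite -natr1; ring.
rewrite lerD//.
by rewrite (snormZ ipP) ger0_norm ?invr_ge0 ?exprn_ge0// ler_wpM2l ?invr_ge0 ?exprn_ge0// je.
Qed.

(** The limit [a] stands for the mean of the orbit of [f] over [0, h]. As [s] tends to 0, [e] may be
    taken arbitrarily small, so the estimate identifies the generator at [a] as h^-1 (P h f - f). *)
Lemma davg_limit_increment a s e :
  (forall e', 0 < e' -> exists N, forall n, (N <= n)%N -> nr (davg n - a) <= e') ->
  0 <= s ->
  (forall t, 0 <= t <= s -> nr (P t (P h f - f) - (P h f - f)) <= e) ->
  nr (P s a - a - (s / h) *: (P h f - f)) <= s / h * e.
Proof.
move=> ha s0 se; apply/ler_addgt0Pr => e1 e1_gt0.
set w := P h f - f in se *.
have e2_gt0 : 0 < e1 / 4 by lra.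
have [N NP] := ha _ e2_gt0.
have [b b0 bP] := csg_continuous0 f e2_gt0.
have nw0 : 0 < nr w + 1 by rewrite ltr_pwDr// snorm_ge0.
have [n [Nn nb nw]] : exists n, [/\ (N <= n)%N, dl n <= b &
    dl n / h * nr w <= e1 / 4].
  (* The grid step must lie below the continuity threshold [b] and also make the share of [w] in one
     step at most [e1 / 4]. *)
  have : 0 < Num.min b (e1 / 4 * h / (nr w + 1)).
    by rewrite lt_min b0 divr_gt0// mulr_gt0.
  set c := Num.min _ _ => c0.
  pose k := maxn N (Num.truncn (h / c)).+1.
  have dlc : dl k <= c.
    rewrite ler_pdivrMr ?exprn_gt0// mulrC -ler_pdivrMr//.
    rewrite (le_trans (ltW (truncnS_gt _)))//.
    rewrite (@le_trans _ _ k%:R) ?ler_nat ?leq_maxr//.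
    by rewrite -natrX ler_nat ltnW// ltn_expl.
  exists k; split.
  - exact: leq_maxl.
  - by rewrite (le_trans dlc)// ge_min lexx.
  - have H : dl k <= e1 / 4 * h / (nr w + 1).
      by rewrite (le_trans dlc)// ge_min lexx orbT.
    rewrite ler_pdivlMr// in H.
    rewrite mulrAC ler_pdivrMr// (le_trans _ H)// ler_wpM2l ?(ltW (dl_gt0 _))//.
    by rewrite lerDl.
pose j := Num.truncn (s / dl n).
have sdl0 : 0 <= s / dl n by rewrite divr_ge0// ltW.
have [js sj] : j%:R * dl n <= s /\ s < j%:R * dl n + dl n.
  have /andP[] := truncn_itv sdl0.
  rewrite -/j ler_pdivlMr// ltr_pdivrMr// => -> H; split => //.
  by rewrite (lt_le_trans H)// -natr1 mulrDl mul1r.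
pose p := s - j%:R * dl n.
have p0 : 0 <= p by rewrite subr_ge0.
have pdl : p <= dl n by rewrite lerBlDl ltW.
have j0 : 0 <= j%:R * dl n by rewrite mulr_ge0// (ltW (dl_gt0 _)).
have je : nr (P (j%:R * dl n) (davg n) - davg n - (j%:R * 2 ^- n) *: w) <=
    j%:R * 2 ^- n * e.
  apply: davg_increment => i ij; apply: se.
  rewrite mulr_ge0 ?(ltW (dl_gt0 _))//= (le_trans _ js)//.
  by rewrite ler_wpM2r ?(ltW (dl_gt0 _))// ler_nat ltnW.
have jsh : j%:R * 2 ^- n <= s / h.
  rewrite ler_pdivlMr// (le_trans _ js)//.
  by rewrite -mulrA [_^-1 * h]mulrC.
have e0 : 0 <= e.
  by apply: le_trans (se 0 _); rewrite ?snorm_ge0// lexx.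
(* Four errors: replacing [a] by [davg n] (twice [e1 / 4]), the remainder [p] of [s] beyond the last
   grid point ([e1 / 4]), the [j] grid steps ([s / h * e]), and the fraction [p / h] of [w] that
   they leave out ([e1 / 4]). *)
have -> : nr (P s a - a - (s / h) *: w) =
    nr (((P s (a - davg n) - (a - davg n)) +
      P (j%:R * dl n) (P p (davg n) - davg n)) +
      (P (j%:R * dl n) (davg n) - davg n - (j%:R * 2 ^- n) *: w) -
      (p / h) *: w).
  apply: (eq_snorm ipP) => z.
  rewrite !(ipDl ipP) !(ipNl ipP) !(ipDl ipP) !(ipZl ipP) !(ipNl ipP) !csgB.
  rewrite -(csg_D PP)// [_ + p]addrC subrK.
  by rewrite /p; field; rewrite ?expf_neq0// gt_eqF.
have n1 := NP _ Nn; rewrite (snormC ipP) in n1.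
have n2 := csg_snorm s (a - davg n).
have n3 := ler_snormB ipP (P s (a - davg n)) (a - davg n).
have n4 : nr (P p (davg n) - davg n) <= e1 / 4.
  by rewrite (le_trans (davg_modulus _ p0))// bP// p0 (le_trans pdl).
have n5 := csg_snorm (j%:R * dl n) (P p (davg n) - davg n).
have n6 : nr ((p / h) *: w) <= e1 / 4.
  rewrite (snormZ ipP) ger0_norm ?divr_ge0 ?(ltW h0)//.
  by rewrite (le_trans _ nw)// ler_wpM2r ?snorm_ge0// ler_pM2r ?invr_gt0.
have n7 : j%:R * 2 ^- n * e <= s / h * e by rewrite ler_wpM2r.
apply: (le_trans (ler_snormB ipP _ _)).
set X1 := (P s _ - _) in n3 *; set X2 := P (j%:R * dl n) _ in n5 *.
set X3 := (_ - _ *: _) in je *.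
have := ler_snormD ipP (X1 + X2) X3; have := ler_snormD ipP X1 X2.
clear -n1 n2 n3 n4 n5 n6 n7 je; lra.
Qed.

End dyadic_average.
End semigroup_theory.

(** * Density of the domain of the generator, and the energy along the semigroup *)

Definition snorm_complete {R : realType} {V : lmodType R} (ip : V -> V -> R) : Prop :=
  forall F : nat -> V,
    (forall e, 0 < e -> exists N, forall n m, (N <= n)%N -> (n <= m)%N ->
      snorm ip (F m - F n) <= e) ->
    exists a, forall e, 0 < e -> exists N, forall n, (N <= n)%N ->
      snorm ip (F n - a) <= e.

Section generator_theory.
Context {R : realType} {V : lmodType R} (ip : V -> V -> R).
Context (ipP : semi_inner ip) (P : R -> V -> V).
Context (PP : contraction_semigroup ip P).
Local Notation nr := (snorm ip).

(** The classical approximant, the mean of the orbit of [f] over a short interval [0, h], is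
    obtained by completeness as the limit of the sums [davg P f h n] instead of as a vector-valued
    integral. *)
Lemma generator_dense f e : snorm_complete ip -> 0 < e ->
  exists g k, in_generator ip P g k /\ nr (g - f) <= e.
Proof.
move=> cpl e0; have [h h0 hP] := csg_continuous0 ipP PP f e0.
have [|a ha] := cpl (davg P f h).
  move=> e1 e1_gt0; have [b b0 bP] := csg_continuous0 ipP PP f e1_gt0.
  exists (Num.truncn (h / b)).+1 => n m Nn nm.
  apply: (davg_cauchy ipP PP h0 nm) => t /andP[t0 tn].
  apply: bP; rewrite t0/= (le_trans tn)//.
  rewrite ler_pdivrMr ?exprn_gt0// mulrC -ler_pdivrMr//.
  rewrite (le_trans (ltW (truncnS_gt _)))//.
  rewrite (@le_trans _ _ n%:R) ?ler_nat//.
  by rewrite -natrX ler_nat ltnW// ltn_expl.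
exists a, (h^-1 *: (P h f - f)); split; last first.
  apply/ler_addgt0Pr => e1 /ha[N /(_ N (leqnn _)) Na].
  have H : nr (davg P f h N - f) <= e.
    by apply: (davg_cauchy ipP PP h0 (leq0n N)); rewrite expr0 divr1.
  rewrite (_ : a - f = (davg P f h N - f) - (davg P f h N - a)).
    by rewrite (le_trans (ler_snormB ipP _ _))// lerD.
  by rewrite opprB [RHS]addrC addrA subrK.
move=> e1 e1_gt0.
have e1h : 0 < e1 * h by rewrite mulr_gt0.
have [b b0 bP] := csg_continuous0 ipP PP (P h f - f) e1h.
exists b => // s /andP[s0 sb].
have := @davg_limit_increment _ _ _ ipP _ PP f _ h0 a s (e1 * h) ha (ltW s0).
move=> H; have {H} : nr (P s a - a - (s / h) *: (P h f - f)) <= s / h * (e1 * h).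
  by apply: H => t /andP[t0 ts]; apply: bP; rewrite t0 (le_trans ts)// ltW.
rewrite (_ : s / h * _ = s * e1); last by field; rewrite gt_eqF.
rewrite (_ : s^-1 *: _ - _ = s^-1 *: (P s a - a - (s / h) *: (P h f - f))).
  by rewrite (snormZ ipP) ger0_norm ?invr_ge0 ?(ltW s0)// ler_pdivrMl.
by rewrite [RHS]scalerBr !scalerA mulrA mulVf ?mul1r// gt_eqF.
Qed.

Lemma generator_csg t g k : 0 <= t ->
  in_generator ip P g k -> in_generator ip P (P t g) (P t k).
Proof.
move=> t0 gk e /gk[a a0 aP]; exists a => // s /[dup] /andP[s0 _] /aP.
apply: le_trans.
have -> : nr (s^-1 *: (P s (P t g) - P t g) - P t k) =
    nr (P t (s^-1 *: (P s g - g) - k)).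
  apply: (eq_snorm ipP) => z.
  rewrite (csgB PP) (csgZ PP) (csgB PP) !(ipBl ipP) (ipZl ipP) (ipBl ipP).
  by rewrite -!(csg_D PP) ?(ltW s0)// [t + s]addrC.
exact: csg_snorm.
Qed.

(** By symmetry, the second difference of <P_a g, g> is the square norm of P_(a/2) g - P_(a/2 + s)
    g. *)
Lemma csg_midpoint g a s : 0 <= a -> 0 <= s ->
  2 * ip (P (a + s) g) g <= ip (P a g) g + ip (P (a + s + s) g) g.
Proof.
move=> a0 s0; have a20 : 0 <= a / 2 by lra.
have as0 : 0 <= a / 2 + s by lra.
have := semi_inner_ge0 ipP (P (a / 2) g - P (a / 2 + s) g).
rewrite (ipBl ipP) !(ipBr ipP) !(csg_mul PP)//.
have -> : a / 2 + a / 2 = a by lra.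
have -> : a / 2 + (a / 2 + s) = a + s by lra.
have -> : a / 2 + s + a / 2 = a + s by lra.
have -> : a / 2 + s + (a / 2 + s) = a + s + s by lra.
by lra.
Qed.

(** By midpoint convexity the decrements along the grid of step [s] do not increase, so [n] times
    the next one is at most the sum of the first [n]. *)
Lemma csg_increment_le g s n : 0 <= s ->
  n%:R * (ip (P (n%:R * s) g) g - ip (P (n.+1%:R * s) g) g) <=
    ip g g - ip (P (n%:R * s) g) g.
Proof.
move=> s0; elim: n => [|n IHn].
  by rewrite !mul0r (csg_0 PP) subrr.
have := @csg_midpoint g (n%:R * s) s (mulr_ge0 (ler0n _ _) s0) s0.
have -> : n%:R * s + s = n.+1%:R * s by rewrite -natr1; ring.
have -> : n.+1%:R * s + s = n.+2%:R * s by rewrite -[n.+2%:R]natr1; ring.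
set w0 := ip (P (n%:R * s) g) g in IHn *.
set w1 := ip (P (n.+1%:R * s) g) g in IHn *.
set w2 := ip (P (n.+2%:R * s) g) g => mid.
have : n%:R * (w1 - w2) <= n%:R * (w0 - w1) by rewrite ler_wpM2l//; lra.
by rewrite -natr1; lra.
Qed.

(* By midpoint convexity of [a |-> ip (P a g) g], its slope at [2 t] is at most
   its mean slope over [[0, 2 t]]. *)
Lemma energy_le t g k : 0 < t -> in_generator ip P g k ->
  - ip (P t k) (P t g) * (2 * t) <= ip g g.
Proof.
move=> t0 /(generator_csg (ltW t0)).
set G := P t g => Gk; apply/ler_addgt0Pr => e e0.
have nG : 0 < nr G + 1 by rewrite ltr_pwDr// snorm_ge0.
have e2 : 0 < e / (2 * t * (nr G + 1)) by rewrite divr_gt0// !mulr_gt0.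
have [a a0 aP] := Gk _ e2.
(* A whole number of steps reaches exactly [2 * t], each step being below the threshold [a] of the
   generator limit. *)
pose n := (Num.truncn (2 * t / a)).+1.
have n0 : 0 < n%:R :> R by rewrite ltr0n.
pose s := 2 * t / n%:R.
have s0 : 0 < s by rewrite divr_gt0// mulr_gt0.
have sa : s < a.
  by rewrite ltr_pdivrMr// -ltr_pdivrMl// mulrC truncnS_gt.
have := aP s; rewrite s0 sa => /(_ isT) nGs.
have ns : n%:R * s = 2 * t by rewrite /s; field; rewrite gt_eqF.
have := csg_increment_le g n (ltW s0).
have -> : n.+1%:R * s = s + 2 * t by rewrite -natr1 -ns; ring.
rewrite ns => incr.
have tt : 2 * t = t + t by ring.
have w0 : 0 <= ip (P (2 * t) g) g.
  by rewrite tt -(csg_mul PP) ?(ltW t0)// (semi_inner_ge0 ipP).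
have GG : ip (P s G - G) G = ip (P (s + 2 * t) g) g - ip (P (2 * t) g) g.
  have st0 : 0 <= s + t by rewrite addr_ge0 ?ltW.
  rewrite (ipBl ipP) tt {2 4}/G !(csg_mul PP) ?(ltW t0) ?(ltW s0)//.
  by rewrite -(csg_D PP) ?(ltW t0)// addrA.
have := ip_abs_le ipP (s^-1 *: (P s G - G) - P t k) G.
rewrite (ipBl ipP) (ipZl ipP) GG ler_norml => /andP[_].
set W := _ - ip (P (2 * t) g) g => H.
have H2 : nr (s^-1 *: (P s G - G) - P t k) * nr G <= e / (2 * t).
  rewrite (le_trans (ler_wpM2r (snorm_ge0 _ _) nGs))//.
  rewrite (_ : e / _ * _ = e / (2 * t) * (nr G / (nr G + 1))); last first.
    by field; rewrite !gt_eqF.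
  rewrite ler_piMr ?divr_ge0 ?mulr_ge0 ?(ltW e0) ?(ltW t0)//.
  by rewrite ler_pdivrMr// mul1r lerDl.
have {H H2} : - ip (P t k) G <= - (s^-1 * W) + e / (2 * t) by lra.
have t20 : 0 < 2 * t by rewrite mulr_gt0.
rewrite -(ler_pM2r t20) => H; rewrite (le_trans H)//.
have -> : (- (s^-1 * W) + e / (2 * t)) * (2 * t) = n%:R * - W + e.
  by rewrite -ns; field; rewrite !gt_eqF.
rewrite lerD2r.
by rewrite opprB (le_trans incr)// lerBlDr lerDl.
Qed.

End generator_theory.

(** * From a super Poincare inequality to ultracontractivity *)

Section ultracontractivity.
Context {R : realType} {V : lmodType R} (ip : V -> V -> R).
Context (ipP : semi_inner ip) (cpl : snorm_complete ip).
Context (P : R -> V -> V) (PP : contraction_semigroup ip P).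
Context (N1 : V -> R) (D : R).
Hypothesis N1_ge0 : forall x, 0 <= N1 x.
Hypothesis N1D : forall x y, N1 (x + y) <= N1 x + N1 y.
Hypothesis N1_le : forall x, N1 x <= D * snorm ip x.
Hypothesis N1P : forall t x, N1 (P t x) <= N1 x.
Local Notation nr := (snorm ip).

(** On the domain of the generator, the hypothesis is applied to [P t g] and the energy bounded by
    [energy_le]. Both sides are continuous in the norm, [N1] through [N1_le], so density gives every
    [f]. *)
Lemma super_poincare_semigroup r b : 0 <= r -> 0 <= b ->
  (forall g k, in_generator ip P g k -> ip g g <= r * - ip k g + b * N1 g ^+ 2) ->
  forall t f, 0 < t ->
    ip (P t f) (P t f) <= r / (2 * t) * ip f f + b * N1 f ^+ 2.
Proof.
move=> r0 b0 sp t f t0.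
have gen g k : in_generator ip P g k ->
    ip (P t g) (P t g) <= r / (2 * t) * ip g g + b * N1 g ^+ 2.
  move=> gk; have := sp _ _ (generator_csg ipP PP (ltW t0) gk).
  move=> H; rewrite (le_trans H)// lerD//.
    rewrite -mulrA ler_wpM2l// mulrC ler_pdivlMr ?mulr_gt0//.
    exact: (energy_le ipP PP).
  by rewrite ler_wpM2l// ler_pXn2r ?nnegrE.
pose c := r / (2 * t); have c0 : 0 <= c by rewrite divr_ge0// mulr_ge0// ltW.
pose D' := `|D|; have D'0 : 0 <= D' by exact: normr_ge0.
(* The sum of the coefficients of [d] in the three errors made by replacing [f] with a vector [g] at
   distance at most [d]; squares of [d] are bounded by [d], as [d <= 1]. *)
pose K := 2 * nr (P t f) + c * (2 * nr f + 1) + b * (2 * N1 f * D' + D' ^+ 2).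
have K0 : 0 <= K.
  have := snorm_ge0 ip f; have := snorm_ge0 ip (P t f); have := N1_ge0 f.
  by rewrite /K => ? ? ?; rewrite !addr_ge0// mulr_ge0// addr_ge0// !mulr_ge0.
apply/ler_addgt0Pr => e e0; rewrite -/c.
pose d := Num.min 1 (e / (K + 1)).
have d0 : 0 < d by rewrite lt_min ltr01 divr_gt0// ltr_pwDr.
have d1 : d <= 1 by rewrite ge_min lexx.
have dK : d * K <= e.
  rewrite (@le_trans _ _ (e / (K + 1) * K))//.
    by rewrite ler_wpM2r// ge_min lexx orbT.
  by rewrite mulrAC ler_pdivrMr ?ltr_pwDr// ler_wpM2l ?(ltW e0)// lerDl.
have [g [k [gk gf]]] := generator_dense ipP PP f cpl d0.
have := gen _ _ gk; rewrite -!(sqr_snorm ipP) -/c.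
have n1 : nr (P t f) <= nr (P t g) + d.
  rewrite -lerBlDl (le_trans (snorm_sub_le ipP _ _))//.
  rewrite (le_trans _ gf)// (snormC ipP g f).
  rewrite (@eq_snorm _ _ _ ipP _ (P t (f - g))) ?csg_snorm// => z.
  by rewrite (ipBl ipP) (csgB PP).
have n2 : nr g <= nr f + d by rewrite -lerBlDl (le_trans (snorm_sub_le ipP _ _)).
have n3 : N1 g <= N1 f + D' * d.
  rewrite -[in leLHS](subrK f g) addrC (le_trans (N1D _ _))// lerD2l.
  rewrite (le_trans (N1_le _))// (@le_trans _ _ (D' * nr (g - f)))//.
    by rewrite ler_wpM2r ?snorm_ge0// ler_norm.
  by rewrite ler_wpM2l.
have m1 : nr (P t f) ^+ 2 <= nr (P t g) ^+ 2 + 2 * nr (P t f) * d.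
  move: n1 (snorm_ge0 ip (P t f)) (snorm_ge0 ip (P t g)) d0.
  clear; set x := nr (P t f); set y := nr (P t g) => xy x0 y0 d0.
  have [xd|/ltW dx] := leP x d; first by nra.
  have : (x - d) * (x - d) <= y * y by apply: ler_pM; lra.
  by nra.
have m2 : nr g ^+ 2 <= nr f ^+ 2 + (2 * nr f + 1) * d.
  move: n2 (snorm_ge0 ip f) (snorm_ge0 ip g) d0 d1.
  clear; set x := nr g; set y := nr f => xy x0 y0 d0 d1.
  have : x * x <= (y + d) * (y + d) by apply: ler_pM; lra.
  by nra.
have m3 : N1 g ^+ 2 <= N1 f ^+ 2 + (2 * N1 f * D' + D' ^+ 2) * d.
  have H : N1 g ^+ 2 <= (N1 f + D' * d) ^+ 2.
    by rewrite ler_pXn2r ?nnegrE// addr_ge0// mulr_ge0// ltW.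
  have H2 : D' ^+ 2 * d ^+ 2 <= D' ^+ 2 * d.
    by rewrite ler_wpM2l ?exprn_ge0// ler_piMl// ltW.
  apply: (le_trans H).
  have -> : (N1 f + D' * d) ^+ 2 =
      N1 f ^+ 2 + 2 * N1 f * D' * d + D' ^+ 2 * d ^+ 2 by ring.
  have -> : N1 f ^+ 2 + (2 * N1 f * D' + D' ^+ 2) * d =
      N1 f ^+ 2 + 2 * N1 f * D' * d + D' ^+ 2 * d by ring.
  by rewrite lerD2l.
have := ler_wpM2l c0 m2; have := ler_wpM2l b0 m3.
move: dK; rewrite /K; lra.
Qed.

Lemma nash_iteration C q : 0 <= C -> 0 < q ->
  (forall r t f, 0 < r -> 0 < t ->
    ip (P t f) (P t f) <=
      r / (2 * t) * ip f f + C * (1 + r `^ (- q)) * N1 f ^+ 2) ->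
  forall t f, 0 < t -> ip (P t f) (P t f) <=
    2 * C * (1 + (2 `^ (- (q + 1)) * t) `^ (- q)) * N1 f ^+ 2.
Proof.
move=> C0 q0 sp t f.
(* Chosen so that c 2^q = 1/2. Passing from [s] to [s / 2] multiplies the singular part of [a] below
   by 2^q, so [c * a (s / 2)] is at most half of [a s] and the recursion closes. *)
pose c : R := 2 `^ (- (q + 1)).
have c0 : 0 < c by rewrite powR_gt0.
have c2 : c <= 2^-1.
  rewrite /c -[leRHS]powR_inv1// ler_powR ?ler1n//; lra.
have cq : c * 2 `^ q = 2^-1.
  by rewrite /c -powRD ?pnatr_eq0 ?implybT// opprD addrAC addNr add0r powR_inv1.
pose u s := ip (P s f) (P s f); pose B := N1 f ^+ 2.
have B0 : 0 <= B by rewrite exprn_ge0.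
pose a s := 2 * C * (1 + (c * s) `^ (- q)) * B.
have f0 := semi_inner_ge0 ipP f.
(* With [r = c * s] at time [s / 2], the coefficient [r / (2 * t)] is exactly [c]. *)
have step s : 0 < s -> u s <= c * u (s / 2) + 2^-1 * a s.
  move=> s0; have s20 : 0 < s / 2 by rewrite divr_gt0.
  have := sp (c * s) (s / 2) (P (s / 2) f) (mulr_gt0 c0 s0) s20.
  have -> : ip (P (s / 2) (P (s / 2) f)) (P (s / 2) (P (s / 2) f)) = u s.
    rewrite -(csg_D PP) ?(ltW s20)// (semi_inner_sym ipP) -(csg_D PP) ?(ltW s20)//.
    by rewrite -splitr.
  have -> : c * s / (2 * (s / 2)) = c by field; rewrite gt_eqF.
  move=> H; rewrite (le_trans H)// lerD2l.
  have -> : 2^-1 * a s = C * (1 + (c * s) `^ (- q)) * B by rewrite /a; field.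
  rewrite ler_wpM2l ?mulr_ge0 ?addr_ge0 ?powR_ge0//.
  by rewrite ler_pXn2r ?nnegrE.
have ahalf s : 0 < s -> c * a (s / 2) <= 2^-1 * a s.
  move=> s0; rewrite /a; have -> : c * (s / 2) = c * s / 2 by rewrite mulrA.
  have cs0 : 0 <= c * s by rewrite mulr_ge0 ?ltW.
  have -> : (c * s / 2) `^ (- q) = (c * s) `^ (- q) * 2 `^ q.
    by rewrite powRM ?invr_ge0// -powR_inv1// -powRrM mulN1r opprK.
  set X := (c * s) `^ (- q); have X0 : 0 <= X by exact: powR_ge0.
  have -> : c * (2 * C * (1 + X * 2 `^ q) * B) =
      2 * C * B * (c + X * (c * 2 `^ q)) by ring.
  have -> : 2^-1 * (2 * C * (1 + X) * B) = 2 * C * B * (2^-1 + X * 2^-1) by ring.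
  by rewrite cq ler_wpM2l ?mulr_ge0// lerD2r.
have iter n s : 0 < s -> u s <= c ^+ n * ip f f + a s.
  elim: n s => [|n IHn] s s0.
    rewrite expr0 mul1r -[leLHS]addr0 lerD ?(csg_contraction PP)//.
    by rewrite !mulr_ge0// addr_ge0 ?powR_ge0.
  have := IHn (s / 2); rewrite divr_gt0// => /(_ isT) /(ler_wpM2l (ltW c0)).
  have := step _ s0; have := ahalf _ s0.
  rewrite exprS mulrDr mulrA; lra.
move=> t0; apply/ler_addgt0Pr => e e0; rewrite addrC.
pose n := (Num.truncn (ip f f / e)).+1.
rewrite (le_trans (iter n _ t0))// lerD2r.
have cn : c ^+ n <= (2 ^+ n)^-1 by rewrite -exprVn ler_pXn2r ?nnegrE ?(ltW c0).
rewrite (le_trans (ler_wpM2r f0 cn))// mulrC ler_pdivrMr ?exprn_gt0//.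
rewrite mulrC -ler_pdivrMr// (le_trans (ltW (truncnS_gt _)))// -natrX ler_nat.
exact/ltnW/ltn_expl.
Qed.

(** Symmetry splits [P t] into two copies of [P (t / 2)], each controlled by [nash_iteration]; the
    exponent [q + 2] in place of [q + 1] accounts for the halved time. *)
Lemma csg_ip_le C q : 0 <= C -> 0 < q ->
  (forall r g k, 0 < r -> in_generator ip P g k ->
    ip g g <= r * - ip k g + C * (1 + r `^ (- q)) * N1 g ^+ 2) ->
  forall t f g, 0 < t -> ip (P t f) g <=
    2 * C * (1 + (2 `^ (- (q + 2)) * t) `^ (- q)) * N1 f * N1 g.
Proof.
move=> C0 q0 sp t f g t0.
have t20 : 0 < t / 2 by rewrite divr_gt0.
set K := 2 * C * _.
have K0 : 0 <= K by rewrite !mulr_ge0 ?addr_ge0 ?powR_ge0.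
have nK x : nr (P (t / 2) x) <= Num.sqrt K * N1 x.
  rewrite -[N1 x]ger0_norm// -sqrtr_sqr -sqrtrM// ler_sqrt; last first.
    by apply: mulr_ge0 => //; exact: sqr_ge0.
  have -> : K = 2 * C * (1 + (2 `^ (- (q + 1)) * (t / 2)) `^ (- q)).
    rewrite /K; congr (_ * (_ + _ `^ _)).
    have -> : - (q + 2) = - (q + 1) + - 1 by ring.
    by rewrite powRD ?pnatr_eq0 ?implybT// powR_inv1//; ring.
  apply: nash_iteration => // r s h r0 s0.
  apply: super_poincare_semigroup => //; first exact: ltW.
    by rewrite mulr_ge0// addr_ge0// powR_ge0.
  by move=> ? ? ?; exact: sp.
have -> : ip (P t f) g = ip (P (t / 2) f) (P (t / 2) g).
  by rewrite (csg_mul PP) ?ltW// -splitr.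
rewrite (le_trans (ip_le ipP _ _))//.
have -> : K * N1 f * N1 g = (Num.sqrt K * N1 f) * (Num.sqrt K * N1 g).
  by rewrite -{1}(sqr_sqrtr K0); ring.
by rewrite ler_pM ?snorm_ge0.
Qed.

End ultracontractivity.

(** * The space L^2 of a finite measure *)

Notation L2 mu := (LfunType mu (lee1n 2)).

Definition L2_ip {disp : measure_display} {T : measurableType disp} {R : realType}
    (mu : {finite_measure set T -> \bar R}) (f g : L2 mu) : R :=
  \int[mu]_x (f x * g x).

Section L2_space.
Context {disp : measure_display} {T : measurableType disp} {R : realType}.
Variable mu : {finite_measure set T -> \bar R}.
Implicit Types f g h : L2 mu.
Local Notation ip := (@L2_ip _ T R mu).
Local Notation nr := (snorm ip).

Lemma L2_integrable_mul f g : mu.-integrable setT (EFin \o (f \* g)).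
Proof. by apply/Lfun1_integrable; apply: Lfun2_mul_Lfun1; exact: LfunP. Qed.

Lemma L2_integrable f : mu.-integrable setT (EFin \o f).
Proof.
apply/Lfun1_integrable; apply: Lfun_subset12; last exact: LfunP.
exact: fin_num_measure.
Qed.

Lemma L2_ipE f g : (ip f g)%:E = (\int[mu]_x (f x * g x)%:E)%E.
Proof.
by rewrite fineK//; apply: integrable_fin_num => //; exact: L2_integrable_mul.
Qed.

Lemma L2_semi_inner : semi_inner ip.
Proof.
split.
- by move=> f g; apply: eq_Rintegral => x _; rewrite mulrC.
- move=> a f g h; rewrite /L2_ip -RintegralZl//; last exact: L2_integrable_mul.
  rewrite -RintegralD//.
  + by apply: eq_Rintegral => x _ /=; rewrite mulrDl mulrA.
  + exact: (integrableZl measurableT a (L2_integrable_mul f h)).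
  + exact: L2_integrable_mul.
- by move=> f; apply: Rintegral_ge0 => x _; rewrite -expr2 sqr_ge0.
Qed.

Lemma L2norm_snorm f : L2norm mu f = (nr f)%:E.
Proof.
rewrite /L2norm unlock /snorm -powR12_sqrt; last exact: (semi_inner_ge0 L2_semi_inner).
rewrite -poweR_EFin L2_ipE; congr (_ `^ _)%E.
by apply: eq_integral => x _ /=; rewrite powR_mulrn// -normrX ger0_norm ?sqr_ge0.
Qed.

Lemma ae_eq_L2_ip (f1 f2 g : L2 mu) : f1 = f2 %[ae mu] -> ip f1 g = ip f2 g.
Proof.
move=> f12; congr fine; apply: ae_eq_integral => //.
- by apply/measurable_EFinP; exact: measurable_funM.
- by apply/measurable_EFinP; exact: measurable_funM.
- by apply: filterS f12 => x /= /[apply] ->.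
Qed.

Lemma bounded_L2 (f : T -> R) M : measurable_fun setT f ->
  (forall x, `|f x| <= M) -> f \in Lfun mu 2%:E.
Proof.
move=> mf fM; rewrite inE/=; apply/andP; split; rewrite inE//=.
rewrite /finite_norm unlock poweR_lty//.
rewrite (@le_lt_trans _ _ (\int[mu]_x (M `^ 2)%:E)%E)//.
  apply: ge0_le_integral => //.
  - by move=> x _; rewrite lee_fin powR_ge0.
  - apply/measurable_EFinP.
    by apply/(@measurableT_comp _ _ _ _ _ _ (fun x : R => x `^ 2));
      [exact: measurable_powR|exact: measurableT_comp].
  - by move=> x _; rewrite lee_fin ge0_ler_powR// nnegrE (le_trans _ (fM x)).
by rewrite integral_cst// ltey_eq fin_numM// fin_num_measure.
Qed.

Definition L2_of (f : T -> R) (f2 : f \in Lfun mu 2%:E) : L2 mu :=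
  Lfun_Sub (lee1n 2) f2.

Lemma sqr_integrable_L2 (f : T -> R) : measurable_fun setT f ->
  (\int[mu]_x (f x ^+ 2)%:E < +oo)%E -> f \in Lfun mu 2%:E.
Proof.
move=> mf f2; rewrite inE/=; apply/andP; split; rewrite inE//=.
rewrite /finite_norm unlock poweR_lty//.
rewrite (eq_integral (fun x => (f x ^+ 2)%:E))// => x _ /=.
by rewrite powR_mulrn// -normrX ger0_norm ?sqr_ge0.
Qed.

Lemma measurable_L2_mul f g : measurable_fun setT (fun x => (f x * g x)%:E).
Proof. by apply/measurable_EFinP; exact: measurable_funM. Qed.

Definition L1_norm f : R := \int[mu]_x `|f x|.

Lemma L1_normE f : (L1_norm f)%:E = (\int[mu]_x `|f x|%:E)%E.
Proof.
rewrite fineK//; apply: integrable_fin_num => //.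
exact: (integrable_norm (L2_integrable f)).
Qed.

Lemma L1_norm_ge0 f : 0 <= L1_norm f.
Proof. exact: Rintegral_ge0. Qed.

Lemma L1_normD f g : L1_norm (f + g) <= L1_norm f + L1_norm g.
Proof.
rewrite /L1_norm -RintegralD//.
- apply: le_Rintegral => //.
  + exact: (integrable_norm (L2_integrable (f + g))).
  + apply: (integrableD measurableT (integrable_norm (L2_integrable f))
      (integrable_norm (L2_integrable g))).
  + by move=> x _; exact: ler_normD.
- exact: (integrable_norm (L2_integrable f)).
- exact: (integrable_norm (L2_integrable g)).
Qed.

Lemma ip_le_L1_norm f g : (\forall x \ae mu, `|g x| <= 1) -> ip f g <= L1_norm f.
Proof.
move=> g1; rewrite -lee_fin L2_ipE L1_normE.
rewrite (@le_trans _ _ (\int[mu]_x `|(f x * g x)%:E|)%E)//.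
  rewrite (le_trans (lee_abs _))// le_abse_integral//.
  exact: measurable_L2_mul.
apply: ae_ge0_le_integral => //.
- by apply: measurableT_comp => //; exact: measurable_L2_mul.
- by apply/measurable_EFinP; exact: measurableT_comp.
- apply: filterS g1 => x gx _ /=.
  by rewrite lee_fin normrM ler_piMr.
Qed.

Lemma indic_L2_subproof (A : set T) : measurable A ->
  (\1_A : T -> R) \in Lfun mu 2%:E.
Proof.
move=> mA; apply: (@bounded_L2 _ 1); first exact: measurable_indic.
by move=> x; rewrite indicE; case: (x \in A); rewrite ?normr1 ?normr0.
Qed.

Definition indic_L2 (A : set T) (mA : measurable A) : L2 mu :=
  L2_of (indic_L2_subproof mA).

(** Writing |f| = f sgn f, with sgn f a difference of indicators, turns the L^1 norm into pairings,
    to which the symmetry of a semigroup applies. *)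
Lemma L1_norm_sgn f (mp : measurable [set x | 0 < f x])
    (mn : measurable [set x | f x < 0]) :
  L1_norm f = ip f (indic_L2 mp) - ip f (indic_L2 mn).
Proof.
rewrite -(ipBr L2_semi_inner) /L1_norm; apply: eq_Rintegral => x _.
change (`|f x| = f x * (\1_[set x | 0 < f x] x - \1_[set x | f x < 0] x)).
have xin (B : T -> bool) : (x \in [set y | B y]) = B x.
  by apply/idP/idP; rewrite inE.
rewrite !indicE (xin (fun y => 0 < f y)) (xin (fun y => f y < 0)).
case: (ltgtP 0 (f x)) => [fx|fx|<-]; rewrite /= ?normr0 ?mul0r//.
- by rewrite mulr1n mulr0n subr0 mulr1 gtr0_norm.
- by rewrite mulr1n mulr0n sub0r mulrN1 ltr0_norm.
Qed.

Lemma measurable_L2_gt0 f : measurable [set x | 0 < f x].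
Proof.
have mf : measurable_fun setT f by [].
rewrite (_ : [set _ | _] = f @^-1` `]0, +oo[%classic).
  by rewrite -[X in measurable X]setTI; exact: mf.
by apply/seteqP; split => x /=; rewrite in_itv/= andbT.
Qed.

Lemma measurable_L2_lt0 f : measurable [set x | f x < 0].
Proof.
have mf : measurable_fun setT f by [].
rewrite (_ : [set _ | _] = f @^-1` `]-oo, 0[%classic).
  by rewrite -[X in measurable X]setTI; exact: mf.
by apply/seteqP; split => x /=; rewrite in_itv.
Qed.

Lemma L1_norm_le_snorm f :
  L1_norm f <= 2 * nr (indic_L2 (@measurableT _ T)) * nr f.
Proof.
have nr1 A (mA : measurable A) : nr (indic_L2 mA) <= nr (indic_L2 measurableT).
  rewrite ler_sqrt ?(semi_inner_ge0 L2_semi_inner)//.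
  apply: le_Rintegral => //; try exact: L2_integrable_mul.
  move=> x _; change (\1_A x * \1_A x <= \1_setT x * \1_setT x :> R).
  rewrite !indicE in_setT mulr1.
  by case: (_ \in _); rewrite ?mulr1 ?mul0r.
rewrite (L1_norm_sgn (measurable_L2_gt0 f) (measurable_L2_lt0 f)).
have := ip_le L2_semi_inner f (indic_L2 (measurable_L2_gt0 f)).
have := ip_abs_le L2_semi_inner f (indic_L2 (measurable_L2_lt0 f)).
rewrite ler_norml => /andP[+ _].
have := ler_wpM2l (snorm_ge0 ip f) (nr1 _ (measurable_L2_gt0 f)).
have := ler_wpM2l (snorm_ge0 ip f) (nr1 _ (measurable_L2_lt0 f)).
by lra.
Qed.

(** Riesz-Fischer: the increments of a fast subsequence [G] are summable in L^1, so [G] converges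
    almost everywhere; Fatou's lemma then gives convergence in norm. *)
Lemma L2_complete : snorm_complete ip.
Proof.
move=> F hF; have e0 k : 0 < (2 ^+ k)^-1 :> R by rewrite invr_gt0 exprn_gt0.
pose c k := projT1 (cid (hF _ (e0 k))).
have cP k n m : (c k <= n)%N -> (n <= m)%N -> nr (F m - F n) <= (2 ^+ k)^-1.
  exact: projT2 (cid (hF _ (e0 k))) n m.
(* Summing the thresholds makes the indices nondecreasing while keeping [s k] above [c k]. *)
pose s k := (\sum_(i < k.+1) c i)%N.
have cs k : (c k <= s k)%N by rewrite /s big_ord_recr/= leq_addl.
have sS k m : (s k <= s (k + m))%N.
  elim: m => [|m IHm]; first by rewrite addn0.
  by rewrite addnS (leq_trans IHm)// [leqRHS]/s big_ord_recr/= leq_addr.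
pose G k := F (s k).
have GP k m : nr (G (k + m)%N - G k) <= (2 ^+ k)^-1 by exact: cP.
pose D := 2 * nr (indic_L2 (@measurableT _ T)).
have D0 : 0 <= D by rewrite mulr_ge0// snorm_ge0.
pose S x := (\sum_(0 <= k <oo) (`|G k.+1 x - G k x|)%:E)%E.
have mG k : measurable_fun setT (fun x => (`|G k.+1 x - G k x|)%:E).
  by apply/measurable_EFinP; apply: measurableT_comp => //; exact: measurable_funB.
have mS : measurable_fun setT S.
  by apply: ge0_emeasurable_sum => // k x _ _; rewrite lee_fin.
have iS : mu.-integrable setT S.
  apply/integrableP; split => //.
  rewrite (eq_integral S); last first.
    by move=> x _; rewrite gee0_abs// nneseries_ge0// => k _ _; rewrite lee_fin.
  rewrite integral_nneseries//.
  rewrite (@le_lt_trans _ _ (\sum_(0 <= k <oo) (D / (2 ^+ k))%:E)%E)//.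
    apply: lee_nneseries => [k *|k *]; first by apply: integral_ge0 => x _; rewrite lee_fin.
    rewrite (_ : integral _ _ _ = (L1_norm (G k.+1 - G k))%:E); last by rewrite L1_normE.
    rewrite lee_fin (le_trans (L1_norm_le_snorm _))// ler_wpM2l//.
    by have := GP k 1%N; rewrite addn1.
  have -> : (\sum_(0 <= k <oo) (D / 2 ^+ k)%:E)%E = (2 * D / 2 ^+ 0)%:E.
    apply/cvg_lim => //; have := @cvg_geometric_eseries_half R (2 * D) 0.
    apply: cvg_trans; apply: near_eq_cvg; apply: nearW => n.
    rewrite /eseries/=; apply: eq_bigr => k _; congr EFin.
    by rewrite addn1 natrX exprS; field; rewrite expf_neq0.
  exact: ltry.
have cvgG : \forall x \ae mu, cvgn (fun k => G k x).
  have := integrable_ae measurableT iS; apply: filterS => x /(_ I) Sx.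
  have cS : cvgn (series (telescope (fun k => G k x))).
    apply: normed_cvg; apply: nondecreasing_is_cvgn.
      by apply: nondecreasing_series => k _ _ /=; exact: normr_ge0.
    exists (fine (S x)) => _ [n _ <-].
    rewrite -lee_fin fineK// -sumEFin.
    by apply: (@nneseries_lim_ge R (fun k => (`|G k.+1 x - G k x|)%:E) xpredT 0 n)
      => k _ _; rewrite lee_fin.
  have /cvg_ex[l Sl] := cS.
  have : series (telescope (fun k => G k x)) n + G 0%N x @[n --> \oo] --> l + G 0%N x.
    by apply: cvgD => //; exact: cvg_cst.
  by move/cvgP; rewrite telescopeK; under eq_fun do rewrite /= subrK.
(* The upper limit keeps [A] measurable on the whole space; where it is infinite, [fine] returns
   0. *)
pose A x := fine (limn_esup (fun k => (G k x)%:E)).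
have mA : measurable_fun setT A.
  apply: measurableT_comp => //; apply: measurable_fun_limn_esup => k.
  exact/measurable_EFinP.
have cvgA : \forall x \ae mu, G k x @[k --> \oo] --> A x.
  apply: filterS cvgG => x /cvg_ex[l Gl]; rewrite /A.
  have /cvg_limn_einf_sup[_ ->] : (G k x)%:E @[k --> \oo] --> l%:E.
    by apply: cvg_EFin; [exact: nearW|exact: Gl].
  exact: Gl.
have mGA k : measurable_fun setT (fun x => ((G k x - A x) ^+ 2)%:E).
  by apply/measurable_EFinP; apply: measurable_funX; exact: measurable_funB.
(* Fatou's lemma in [m], applied to (G k - G m)^2, whose integral is at most 4^-k for [m >= k]. *)
have GA k : (\int[mu]_x ((G k x - A x) ^+ 2)%:E <= ((2 ^+ k)^-1 ^+ 2)%:E)%E.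
  have mkm m : measurable_fun setT (fun x => ((G k x - G m x) ^+ 2)%:E).
    by apply/measurable_EFinP; apply: measurable_funX; exact: measurable_funB.
  have mlim : measurable_fun setT
      (fun x => limn_einf (fun m => ((G k x - G m x) ^+ 2)%:E)).
    rewrite (_ : (fun _ => _) =
        \- (fun x => limn_esup (fun m => - ((G k x - G m x) ^+ 2)%:E)))%E.
      apply: measurableT_comp => //; apply: measurable_fun_limn_esup => m.
      exact: measurableT_comp.
    apply/funext => x /=.
    by rewrite -[LHS]oppeK -limn_esupN.
  have -> : (\int[mu]_x ((G k x - A x) ^+ 2)%:E =
      \int[mu]_x limn_einf (fun m => ((G k x - G m x) ^+ 2)%:E))%E.
    apply: ae_eq_integral; [exact: measurableT|exact: mGA|exact: mlim|].
    apply: filterS cvgA => x GA _.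
    have GmA : G k x - G m x @[m --> \oo] --> G k x - A x.
      by apply: cvgB => //; exact: cvg_cst.
    have /cvg_limn_einf_sup[-> _] // :
      ((G k x - G m x) ^+ 2)%:E @[m --> \oo] --> ((G k x - A x) ^+ 2)%:E.
    apply: cvg_EFin; first exact: nearW.
    rewrite expr2 (_ : _ \o _ = fun m => (G k x - G m x) * (G k x - G m x)).
      exact: cvgM.
    by apply/funext => m /=; rewrite expr2.
  rewrite (le_trans (fatou _ _ _ _))//; first by move=> n x _; rewrite lee_fin sqr_ge0.
  rewrite limn_einf_lim; apply: lime_le; first exact: is_cvg_einfs.
  exists k => // n /= kn; rewrite (@le_trans _ _ (\int[mu]_x ((G k x - G n x) ^+ 2)%:E)%E)//.
    by apply: ereal_inf_lbound; exists n => //=.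
  rewrite (_ : (\int[mu]_x _)%E = (nr (G n - G k) ^+ 2)%:E).
    rewrite lee_fin ler_pXn2r ?nnegrE ?snorm_ge0 ?invr_ge0 ?exprn_ge0//.
    by rewrite -(subnKC kn) GP.
  rewrite (sqr_snorm L2_semi_inner) L2_ipE; apply: eq_integral => x _.
  by congr EFin; change ((G k x - G n x) ^+ 2 = (G n x - G k x) * (G n x - G k x)); ring.
have A2 : A \in Lfun mu 2%:E.
  have GA2 : (fun x => G 0%N x - A x) \in Lfun mu 2%:E.
    apply: sqr_integrable_L2; first exact: measurable_funB.
    by rewrite (le_lt_trans (GA 0%N))// ltry.
  rewrite (_ : A = (G 0%N - L2_of GA2 : L2 mu)); first exact: LfunP.
  by apply/funext => x; change (A x = G 0%N x - (G 0%N x - A x)); rewrite subKr.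
exists (L2_of A2) => e egt0.
have [k ke] : exists k, (2 ^+ k)^-1 <= e / 2.
  exists (Num.truncn (2 / e)).+1.
  rewrite invf_ple ?posrE ?exprn_gt0 ?divr_gt0// invf_div.
  rewrite (le_trans (ltW (truncnS_gt _)))// -natrX ler_nat.
  exact/ltnW/ltn_expl.
exists (c k) => n cn.
have nGA : nr (G k - L2_of A2) <= (2 ^+ k)^-1.
  rewrite -(@ler_pXn2r _ 2) ?nnegrE ?snorm_ge0 ?(ltW (e0 k))//.
  rewrite -lee_fin (le_trans _ (GA k))// (sqr_snorm L2_semi_inner) L2_ipE.
  by rewrite le_eqVlt; apply/orP; left; apply/eqP/eq_integral => x _.
have nFG : nr (F n - G k) <= (2 ^+ k)^-1.
  have [sn|/ltnW ns] := leqP (s k) n; first exact: cP.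
  by rewrite (snormC L2_semi_inner); exact: cP.
rewrite (_ : F n - _ = (F n - G k) + (G k - L2_of A2)); last by rewrite addrA subrK.
rewrite (le_trans (ler_snormD L2_semi_inner _ _))//.
by move: nGA nFG ke; lra.
Qed.
End L2_space.

(** * Markov semigroups *)

Section markov_semigroup_theory.
Context {disp : measure_display} {T : measurableType disp} {R : realType}.
Variable mu : {finite_measure set T -> \bar R}.
Variable P : R -> (T -> R) -> (T -> R).
Hypothesis HP : markov_semigroup mu P.
Implicit Types f g h : L2 mu.
Local Notation ip := (@L2_ip _ T R mu).
Local Notation nr := (snorm ip).

(** The absolute value makes membership in L^2, and the laws stated without a sign condition, hold
    for every real [t]. *)
Definition L2_csg (t : R) f : L2 mu :=
  L2_of (semigroup_L2 HP (normr_ge0 t) (LfunP f)).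

Lemma L2_csgE t f : 0 <= t -> L2_csg t f = P t f :> (T -> R).
Proof. by move=> t0; rewrite /L2_csg /= ger0_norm. Qed.

Lemma L2_contraction_semigroup : contraction_semigroup ip L2_csg.
Proof.
split.
- move=> t a x y z; rewrite -(semi_inner_linear (L2_semi_inner mu)).
  apply: ae_eq_L2_ip.
  exact: (semigroup_linear HP a (normr_ge0 t) (LfunP x) (LfunP y)).
- move=> x z; apply: ae_eq_L2_ip.
  rewrite L2_csgE//; exact: (semigroup0 HP (LfunP x)).
- move=> s t x z s0 t0; apply: ae_eq_L2_ip.
  rewrite !L2_csgE ?addr_ge0//.
  exact: (semigroupD HP s0 t0 (LfunP x)).
- move=> t x; rewrite -!(sqr_snorm (L2_semi_inner mu)) ler_pXn2r ?nnegrE ?snorm_ge0//.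
  rewrite -lee_fin -!L2norm_snorm.
  exact: (semigroup_contraction HP (normr_ge0 t) (LfunP x)).
- move=> t x y; apply/EFin_inj; rewrite !L2_ipE.
  exact: (semigroup_symmetric HP (normr_ge0 t) (LfunP x) (LfunP y)).
- move=> x e e0; have := semigroup_continuous HP (LfunP x).
  move/fine_cvgP => [_ /cvgr0Pnorm_le /(_ _ e0)].
  move=> [a /= a0 aP]; exists a => // t /andP[t0 ta].
  have := aP t; rewrite /= sub0r normrN gtr0_norm// => /(_ ta t0).
  rewrite (_ : L2norm _ _ = (nr (L2_csg t x - x))%:E); last first.
    rewrite -L2norm_snorm; congr (L2norm _ _).
    by apply/funext => y /=; rewrite -L2_csgE// ltW.
  by rewrite /= ger0_norm// snorm_ge0.
Qed.

Lemma in_generator_L2 g k : in_generator ip L2_csg g k -> generator mu P g k.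
Proof.
move=> gk; split; [exact: LfunP|exact: LfunP|].
have E t : 0 < t -> L2norm mu (fun x => t^-1 * (P t g x - g x) - k x) =
    (nr (t^-1 *: (L2_csg t g - g) - k))%:E.
  move=> t0; rewrite -L2norm_snorm; congr (L2norm _ _).
  by apply/funext => x; rewrite -L2_csgE// ltW.
apply/fine_cvgP; split.
  exists 1 => //= t _ t0; rewrite E//.
apply/cvgr0Pnorm_le => e e0.
have [a a0 aP] := gk _ e0.
exists a => //= t; rewrite /ball_/= sub0r normrN => + t0; rewrite gtr0_norm// => ta.
by rewrite /= E//= ger0_norm ?snorm_ge0// aP// t0.
Qed.

Lemma L2_csg_indic t A (mA : measurable A) :
  \forall x \ae mu, 0 <= L2_csg t (indic_L2 mu mA) x <= 1.
Proof.
apply: (semigroup_markov HP (normr_ge0 t) (LfunP _)).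
apply: aeW => x.
change (0 <= (\1_A x : R) <= 1).
by rewrite indicE; case: (_ \in _); rewrite /= ?lexx ?ler01.
Qed.

(** Duality: the L^1 norm of [P t f] is the pairing of [f] with P t (sgn (P t f)). By the Markov
    property the latter is a difference of two functions with values in [0, 1] almost everywhere,
    hence bounded by 1. *)
Lemma L1_norm_csg t f : L1_norm (L2_csg t f) <= L1_norm f.
Proof.
set g := L2_csg t f.
rewrite (L1_norm_sgn (measurable_L2_gt0 g) (measurable_L2_lt0 g)).
rewrite -(ipBr (L2_semi_inner mu)) (csg_sym L2_contraction_semigroup).
rewrite -(semi_inner_sym (L2_semi_inner mu)).
rewrite (csgB L2_contraction_semigroup) -(ipBl (L2_semi_inner mu)).
rewrite (semi_inner_sym (L2_semi_inner mu)).
apply: ip_le_L1_norm.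
have := L2_csg_indic t (measurable_L2_gt0 g).
have := L2_csg_indic t (measurable_L2_lt0 g).
apply: filterS2 => x; set a := L2_csg _ _ x; set b := L2_csg _ _ x => a01 b01.
change (`|b - a| <= 1).
rewrite ler_norml; lra.
Qed.

(** Test with the indicator of {f > M}: the integral of f - M over this set is at most 0 while the
    integrand is nonnegative, so it vanishes almost everywhere. *)
Lemma ae_le_of_ip_le f M : 0 <= M ->
  (forall g, ip f g <= M * L1_norm g) -> \forall x \ae mu, f x <= M.
Proof.
move=> M0 fM.
have mf : measurable_fun setT f by [].
have mA : measurable [set x | M < f x].
  rewrite (_ : [set _ | _] = f @^-1` `]M, +oo[%classic).
    by rewrite -[X in measurable X]setTI; exact: mf.
  by apply/seteqP; split => x /=; rewrite in_itv/= andbT.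
pose A := indic_L2 mu mA; pose w := f - M *: indic_L2 mu measurableT.
have wE x : w x = f x - M.
  change (f x - M * \1_[set: T] x = f x - M); rewrite indicE in_setT mulr1//.
have wA0 x : 0 <= w x * A x.
  rewrite wE; change (0 <= (f x - M) * \1_[set x | M < f x] x).
  rewrite indicE; have [xA|_] := boolP (x \in _); last by rewrite mulr0.
  by rewrite mulr1 subr_ge0 ltW//; move: xA; rewrite inE.
have L1A : L1_norm A = ip (indic_L2 mu measurableT) A.
  apply: eq_Rintegral => x _.
  change (`|\1_[set x | M < f x] x| = \1_[set: T] x * \1_[set x | M < f x] x :> R).
  by rewrite [\1_[set: T] x]indicE in_setT mul1r ger0_norm.
have wA : (\int[mu]_x `|(w x * A x)%:E| = 0)%E.
  rewrite (eq_integral (fun x => (w x * A x)%:E)); last first.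
    by move=> x _; rewrite gee0_abs// lee_fin.
  rewrite -L2_ipE; apply/eqP; rewrite eqe eq_le; apply/andP; split.
    rewrite (ipBl (L2_semi_inner mu)) (ipZl (L2_semi_inner mu)) subr_le0 -L1A.
    exact: fM.
  by apply: Rintegral_ge0 => x _.
move/(ae_eq_integral_abs _ measurableT (@measurable_L2_mul _ _ _ mu w A)) : wA.
apply: filterS => x /(_ I) [wx0]; have {wx0} : w x * A x = 0 by exact: wx0.
rewrite wE; change ((f x - M) * \1_[set x | M < f x] x = 0 -> f x <= M).
rewrite indicE; have [xA|xA _] := boolP (x \in _).
  by rewrite mulr1 => /eqP; rewrite subr_eq0 => /eqP ->.
by rewrite leNgt; apply/negP => fx; move/negP : xA; apply; rewrite inE.
Qed.

Lemma opnorm_1y_le t M : 0 <= t -> 0 <= M ->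
  (forall f g, ip (L2_csg t f) g <= M * L1_norm f * L1_norm g) ->
  (opnorm mu 1 +oo (P t) <= M%:E)%E.
Proof.
move=> t0 M0 fM; apply: ge_ereal_sup => _ [f [f2 f1] <-].
pose F := L2_of f2.
have F1 : L1_norm F <= 1.
  by rewrite -lee_fin L1_normE; rewrite Lnorm1 in f1.
have bd (h : L2 mu) : L1_norm h <= 1 -> \forall x \ae mu, L2_csg t h x <= M.
  move=> h1; apply: ae_le_of_ip_le => // g.
  rewrite (le_trans (fM _ _))// ler_wpM2r ?L1_norm_ge0//.
  by rewrite -[leRHS]mulr1 ler_wpM2l.
(* The L^oo norm is 0 by convention when the whole space has measure 0. *)
rewrite unlock; case: ifPn => // _.
apply/ess_supP.
have NF1 : L1_norm (- F) <= 1.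
  rewrite (_ : L1_norm _ = L1_norm F)//; apply: eq_Rintegral => x _.
  by change (`|- f x| = `|f x|); rewrite normrN.
(* [P t (- F)] and [- P t F] need only agree almost everywhere, so they are compared through their
   pairings. *)
have lin : ip (L2_csg t (- F)) =1 ip (- L2_csg t F).
  by move=> g; rewrite -scaleN1r (csgZ L2_contraction_semigroup)
    (ipNl (L2_semi_inner mu)) mulN1r.
have bdN : \forall x \ae mu, (- L2_csg t F) x <= M.
  apply: ae_le_of_ip_le => // g; rewrite -lin.
  rewrite (le_trans (fM _ _))// ler_wpM2r ?L1_norm_ge0//.
  by rewrite -[leRHS]mulr1 ler_wpM2l.
move: (bd _ F1) bdN; apply: filterS2 => x.
change (L2_csg t F x <= M -> - L2_csg t F x <= M -> (`|P t f x|%:E <= M%:E)%E).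
rewrite L2_csgE// => a b.
by rewrite /= lee_fin ler_norml a andbT lerNl.
Qed.

End markov_semigroup_theory.

(** The form enters only through the generator: if the generator maps [f] to [h], the energy of [f]
    is minus the integral of [h * f]. *)
Theorem opnorm_of_super_poincare {disp : measure_display}
    {T : measurableType disp} {R : realType}
    (mu : {finite_measure set T -> \bar R}) (C q : R) : 0 <= C -> 0 < q ->
  forall P, markov_semigroup mu P ->
  (forall r f h, 0 < r -> generator mu P f h ->
    ((\int[mu]_x (f x ^+ 2)%:E) <= r%:E * (- \int[mu]_x (h x * f x)%:E) +
      (C * (1 + r `^ (- q)))%:E * (\int[mu]_x `|f x|%:E) ^+ 2)%E) ->
  forall t, 0 < t -> (opnorm mu 1 +oo (P t) <=
    (2 * C * (1 + (2 `^ (- (q + 2)) * t) `^ (- q)))%:E)%E.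
Proof.
move=> C0 q0 P HP sp t t0.
apply: (@opnorm_1y_le _ _ _ _ _ HP _ _ (ltW t0)).
  by rewrite !mulr_ge0// addr_ge0// powR_ge0.
move=> f g.
apply: (csg_ip_le (L2_semi_inner mu) (@L2_complete _ _ _ mu) (L2_contraction_semigroup HP)
  (@L1_norm_ge0 _ _ _ mu) (@L1_normD _ _ _ mu) (@L1_norm_le_snorm _ _ _ mu)
  (L1_norm_csg HP) C0 q0) => // r h k r0 hk.
have := sp r h k r0 (in_generator_L2 hk).
have -> : (\int[mu]_x (h x ^+ 2)%:E = (L2_ip h h)%:E)%E by rewrite L2_ipE.
by rewrite -L2_ipE -L1_normE -EFin_expe -EFinN -!EFinM -EFinD lee_fin.
Qed.

(** * Integration against the Gibbs measure *)

(** The Radon-Nikodym derivative of [nu] has the same integral as [w] over every measurable set, so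
    the two agree almost everywhere. *)
Lemma integral_density {disp : measure_display} {T : measurableType disp} {R : realType}
    (m : {sigma_finite_measure set T -> \bar R}) (nu : {finite_measure set T -> \bar R})
    (w f : T -> \bar R) :
  m.-integrable setT w ->
  (forall A, measurable A -> nu A = \int[m]_(x in A) w x)%E ->
  measurable_fun setT f -> (forall x, 0 <= f x)%E ->
  (\int[nu]_x f x = \int[m]_x (f x * w x))%E.
Proof.
move=> iw nuE mf f0.
have numu : nu `<< m.
  apply/null_content_dominatesP => A mA mA0; rewrite nuE//.
  by apply: null_set_integral => //; apply: measurable_funTS; exact: measurable_int iw.
rewrite -(Radon_Nikodym_SigmaFinite.change_of_variables numu f0)//.
set g := Radon_Nikodym_SigmaFinite.f _ _.
have ig : m.-integrable setT g by exact: Radon_Nikodym_SigmaFinite.f_integrable.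
apply: ae_eq_integral => //.
- by apply: emeasurable_funM => //; exact: measurable_int ig.
- by apply: emeasurable_funM => //; exact: measurable_int iw.
- apply: ae_eqe_mul2l; apply: integral_ae_eq => //; first exact: measurable_int iw.
  by move=> A _ mA; rewrite -nuE// -Radon_Nikodym_SigmaFinite.f_integral.
Qed.

Lemma measurable_tnth_euclidean {R : realType} d (i : 'I_d) :
  measurable_fun setT (fun x : euclidean R d => tnth x i : R).
Proof. exact: measurable_tnth. Qed.

Lemma measurable_edist {R : realType} d :
  measurable_fun setT (fun z : euclidean R d * euclidean R d => edist z.1 z.2).
Proof.
apply: (@measurableT_comp _ _ _ _ _ _ (@Num.sqrt R)).
  by apply: continuous_measurable_fun; exact: sqrt_continuous.
apply: measurable_sum => i; apply: measurable_funX; apply: measurable_funB.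
  exact: (measurableT_comp (measurable_tnth_euclidean i) measurable_fst).
exact: (measurableT_comp (measurable_tnth_euclidean i) measurable_snd).
Qed.

Lemma edistC {R : realType} d (x y : euclidean R d) : edist x y = edist y x.
Proof.
by congr Num.sqrt; apply: eq_bigr => i _; rewrite -opprB sqrrN.
Qed.

Lemma edist_eq0 {R : realType} d (x y : euclidean R d) : edist x y = 0 -> x = y.
Proof.
move=> /eqP; rewrite sqrtr_eq0 => xy0; apply/eq_from_tnth => i; apply/eqP.
rewrite -subr_eq0 -sqrf_eq0.
suff /psumr_eq0P : \sum_(i < d) ((tnth x i : R) - (tnth y i : R)) ^+ 2 = 0.
  by move=> ->// j _; exact: sqr_ge0.
by apply/eqP; rewrite eq_le xy0 sumr_ge0// => j _; exact: sqr_ge0.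
Qed.

Lemma dirichlet_form_ge0 {R : realType} d (alpha : R) (V : {mfun euclidean R d >-> R})
    (f : euclidean R d -> R) : (0 <= dirichlet_form alpha V f f)%E.
Proof.
apply: integral_ge0 => z _; rewrite lee_fin divr_ge0 ?powR_ge0//.
by rewrite -expr2 sqr_ge0.
Qed.

Section gibbs_kernel.
Context {R : realType} (d : nat).
Variables (alpha : R) (V : {mfun euclidean R d >-> R}) (z0 : R).
Hypothesis z0_gt0 : 0 < z0.
Hypothesis z0E : partition_function V = z0%:E.
Local Notation T := (euclidean R d).
Local Notation la := (lebesgue_tuple d).
Local Notation mu := (gibbs V).
Implicit Types f : T -> R.

Let dens (x : T) : R := z0^-1 * expR (- V x).

Let dens_ge0 x : 0 <= dens x.
Proof. by rewrite mulr_ge0 ?invr_ge0 ?(ltW z0_gt0)// expR_ge0. Qed.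

Let mexpNV : measurable_fun setT (fun x => expR (- V x)).
Proof. by apply: measurableT_comp => //; exact: measurable_funN. Qed.

Let mdens : measurable_fun setT dens.
Proof. exact: measurable_funM. Qed.

Lemma integral_gibbs (f : T -> \bar R) : measurable_fun setT f ->
  (forall x, 0 <= f x)%E ->
  (\int[mu]_x f x = \int[la]_x (f x * (z0^-1 * expR (- V x))%:E))%E.
Proof.
move=> mf f0; rewrite (@integral_density _ _ _ la mu (EFin \o dens))//.
- apply/integrableP; split; first exact/measurable_EFinP.
  rewrite (eq_integral (fun x => z0^-1%:E * (expR (- V x))%:E)%E); last first.
    by move=> x _; rewrite gee0_abs ?lee_fin.
  rewrite ge0_integralZl_EFin ?invr_ge0 ?(ltW z0_gt0)//; last first.
  + exact/measurable_EFinP.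
  by rewrite -[X in (_ * X < _)%E]/(partition_function V) z0E -EFinM ltry.
- move=> A mA.
  transitivity ((fine (partition_function V))^-1%:E *
    \int[la]_(x in A) (expR (- V x))%:E)%E; first by [].
  rewrite z0E /=.
  rewrite -ge0_integralZl_EFin ?invr_ge0 ?(ltW z0_gt0)//.
  by apply/measurable_EFinP; exact: measurable_funTS.
Qed.

Lemma integral_gibbs_prod (phi : T * T -> R) : measurable_fun setT phi ->
  (forall z, 0 <= phi z) ->
  (\int[mu \x la]_z (phi z)%:E =
   \int[la]_x \int[la]_y (phi (x, y) * (z0^-1 * expR (- V x)))%:E)%E.
Proof.
move=> mphi phi0.
rewrite fubini_tonelli1/=; [|exact/measurable_EFinP|by move=> z; rewrite lee_fin].
rewrite integral_gibbs; last 2 first.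
- apply: (measurable_fun_fubini_tonelli_F (fun z => (phi z)%:E)).
    exact/measurable_EFinP.
  by move=> z; rewrite lee_fin.
- by move=> x; apply: integral_ge0 => y _; rewrite lee_fin.
apply: eq_integral => x _.
rewrite -ge0_integralZr//.
- by apply/measurable_EFinP; exact: measurableT_comp.
- by move=> y _; rewrite lee_fin.
- by rewrite lee_fin; exact: dens_ge0.
Qed.

(** Exchanging the variables moves the weight e^(-V) from one to the other; the factor e^(V(x) -
    V(y)) compensates for this. *)
Lemma integral_gibbs_swap (phi : T * T -> R) : measurable_fun setT phi ->
  (forall z, 0 <= phi z) ->
  (\int[mu \x la]_z (phi (z.2, z.1) * expR (V z.1 - V z.2))%:E =
   \int[mu \x la]_z (phi z)%:E)%E.
Proof.
move=> mphi phi0.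
have mswap : measurable_fun setT (fun z : T * T => phi (z.2, z.1)).
  by apply: (measurableT_comp mphi); exact: measurable_swap.
have mV1 : measurable_fun setT (fun z : T * T => V z.1).
  by apply: measurableT_comp.
have mV2 : measurable_fun setT (fun z : T * T => V z.2).
  by apply: measurableT_comp.
rewrite (integral_gibbs_prod (phi := fun z => phi (z.2, z.1) * expR (V z.1 - V z.2)));
    last 2 first.
- apply: measurable_funM => //; apply: measurableT_comp => //.
  exact: measurable_funB.
- by move=> z; rewrite mulr_ge0// expR_ge0.
rewrite (integral_gibbs_prod mphi phi0).
rewrite (fubini_tonelli (fun z => (phi z * (z0^-1 * expR (- V z.1)))%:E))/=; last 2 first.
- apply/measurable_EFinP; apply: measurable_funM => //; apply: measurable_funM => //.
  by apply: measurableT_comp => //; exact: measurable_funN.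
- by move=> z; rewrite lee_fin mulr_ge0//; exact: dens_ge0.
apply: eq_integral => x _; apply: eq_integral => y _; congr EFin.
rewrite -mulrA; congr (_ * _).
by rewrite mulrCA -expRD addrAC subrr add0r.
Qed.

(** The weight e^(-V(y)) turns dy into [z0] times mu(dy), so the double integral factors. *)
Lemma integral_gibbs_tensor f : measurable_fun setT f ->
  (\int[mu \x la]_z (`|f z.1| * (`|f z.2| * expR (- V z.2)))%:E =
   z0%:E * (\int[mu]_x `|f x|%:E) ^+ 2)%E.
Proof.
move=> mf.
have mf1 : measurable_fun setT (fun x => `|f x|) by exact: measurableT_comp.
rewrite fubini_tonelli1/=; last 2 first.
- apply/measurable_EFinP; apply: measurable_funM.
    exact: (measurableT_comp mf1 measurable_fst).
  apply: measurable_funM; first exact: (measurableT_comp mf1 measurable_snd).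
  exact: (measurableT_comp mexpNV measurable_snd).
- by move=> z; rewrite lee_fin !mulr_ge0// expR_ge0.
have E : (\int[la]_y (`|f y| * expR (- V y))%:E = z0%:E * \int[mu]_x `|f x|%:E)%E.
  rewrite integral_gibbs//; last exact/measurable_EFinP.
  rewrite -ge0_integralZl_EFin ?(ltW z0_gt0)//.
  - apply: eq_integral => y _; rewrite -!EFinM; congr EFin.
    by field; rewrite gt_eqF.
  - by move=> x _; rewrite -EFinM lee_fin mulr_ge0//; exact: dens_ge0.
  - by apply: emeasurable_funM; apply/measurable_EFinP.
transitivity (\int[mu]_x (`|f x|%:E * (z0%:E * \int[mu]_x `|f x|%:E)))%E.
  apply: eq_integral => x _; rewrite -E -ge0_integralZl//.
  by apply/measurable_EFinP; exact: measurable_funM.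
rewrite ge0_integralZr//.
- by rewrite muleCA.
- exact/measurable_EFinP.
- by rewrite mule_ge0 ?lee_fin ?(ltW z0_gt0)// integral_ge0.
Qed.

End gibbs_kernel.

(** * Energy estimate over a family of neighbourhoods *)

Section truncated_energy.
Context {R : realType} (d : nat).
Variables (alpha : R) (V : {mfun euclidean R d >-> R}) (z0 : R).
Hypothesis z0_gt0 : 0 < z0.
Hypothesis z0E : partition_function V = z0%:E.
Local Notation T := (euclidean R d).
Local Notation la := (lebesgue_tuple d).
Local Notation mu := (gibbs V).
Local Notation p := (d%:R + alpha).
Variable f : T -> R.
Hypothesis mf : measurable_fun setT f.

Let k (z : T * T) : R := (f z.1 - f z.2) * (f z.1 - f z.2) / edist z.1 z.2 `^ p.

Let k_ge0 z : 0 <= k z.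
Proof. by rewrite divr_ge0 ?powR_ge0// -expr2 sqr_ge0. Qed.

Let mf1 : measurable_fun setT (fun z : T * T => f z.1).
Proof. exact: (measurableT_comp mf measurable_fst). Qed.

Let mf2 : measurable_fun setT (fun z : T * T => f z.2).
Proof. exact: (measurableT_comp mf measurable_snd). Qed.

Let mexpV : measurable_fun setT (fun z : T * T => expR (V z.1 - V z.2)).
Proof.
apply: measurableT_comp => //; apply: measurable_funB; exact: measurableT_comp.
Qed.

Let mk : measurable_fun setT k.
Proof.
apply: measurable_funM.
  by apply: measurable_funM; exact: measurable_funB.
rewrite (_ : (fun _ => _) = fun z : T * T => edist z.1 z.2 `^ (- p)).
  by apply: (measurableT_comp (measurable_powR (- p))); exact: measurable_edist.
by apply/funext => z; rewrite powRN.
Qed.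

(* [a^2 <= (a - b)^2 + 2 |a| |b|], integrated over the pairs [(x, y)] with
   [x] in [D] and [y] in a set [A x] of Lebesgue measure [m]. *)
Lemma truncated_energy (D : set T) (A : T -> set T) (m rho B : R) :
  0 < p -> 0 <= m -> 0 <= rho -> 0 <= B -> measurable D ->
  measurable [set z : T * T | D z.1 /\ A z.1 z.2] ->
  (forall x, D x -> la (A x) = m%:E) ->
  (forall x y, D x -> A x y -> expR (V y) <= B) ->
  (forall x y, D x -> A x y -> edist x y `^ p <= rho * (1 + expR (V x - V y))) ->
  (m%:E * \int[mu]_(x in D) (f x ^+ 2)%:E <=
    (2 * rho)%:E * dirichlet_form alpha V f f +
    (2 * B * z0)%:E * (\int[mu]_x `|f x|%:E) ^+ 2)%E.
Proof.
move=> p0 m0 rho0 B0 mD; set G := [set z : T * T | _] => mG Am VB dist.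
pose t (z : T * T) : R := `|f z.1| * (`|f z.2| * expR (- V z.2)).
(* The integrand of the form with its two variables exchanged, hence with the same integral; the
   factor 1 + e^(V(x) - V(y)) in the distance bound is what produces [k + k']. *)
pose k' (z : T * T) : R := k z * expR (V z.1 - V z.2).
have mt : measurable_fun setT t.
  apply: measurable_funM; first exact: measurableT_comp.
  apply: measurable_funM; first exact: measurableT_comp.
  by apply: measurableT_comp => //; apply: measurable_funN; exact: measurableT_comp.
have t_ge0 z : 0 <= t z by rewrite !mulr_ge0// expR_ge0.
have mk' : measurable_fun setT k' by exact: measurable_funM.
have k'_ge0 z : 0 <= k' z by rewrite mulr_ge0// expR_ge0.
have Ek : (\int[mu \x la]_z (k z)%:E = dirichlet_form alpha V f f)%E by [].
have Ek' : (\int[mu \x la]_z (k' z)%:E = dirichlet_form alpha V f f)%E.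
  rewrite -Ek -(integral_gibbs_swap z0_gt0 z0E mk k_ge0).
  apply: eq_integral => z _; rewrite /k' (_ : k z = k (z.2, z.1))//.
  by rewrite /k /= edistC; congr (_ / _); ring.
have Et : (\int[mu \x la]_z (t z)%:E = z0%:E * (\int[mu]_x `|f x|%:E) ^+ 2)%E.
  exact: integral_gibbs_tensor.
have m1G : measurable_fun setT (fun z : T * T => \1_G z * f z.1 ^+ 2).
  apply: measurable_funM; last exact: measurable_funX.
  exact: measurable_indic.
(* By Tonelli: for fixed [x], the section of [G] has Lebesgue measure [m] if [x] is in [D] and is
   empty otherwise. *)
have -> : (m%:E * \int[mu]_(x in D) (f x ^+ 2)%:E =
    \int[mu \x la]_z (\1_G z * f z.1 ^+ 2)%:E)%E.
  rewrite fubini_tonelli1/=; last 2 first.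
  - exact/measurable_EFinP.
  - by move=> z; rewrite lee_fin mulr_ge0 ?sqr_ge0// indicE.
  rewrite integral_mkcond -ge0_integralZl_EFin//; last 2 first.
  - by move=> x _; apply: erestrict_ge0 => y _; rewrite lee_fin sqr_ge0.
  - apply/(measurable_restrictT _ _).1 => //; apply: measurable_funTS.
    by apply/measurable_EFinP; exact: measurable_funX.
  apply: eq_integral => x _; rewrite patchE; case: ifPn => [|/negP] xD.
    have {}xD : D x by rewrite inE in xD.
    have AG : A x = xsection G x.
      by apply/seteqP; split => y; rewrite xsectionE /G /= => // -[].
    have mGx : measurable (xsection G x) by exact: measurable_xsection.
    have -> : (m%:E = \int[la]_y (\1_(xsection G x) y)%:E)%E.
      by rewrite integral_indic// setIT -AG; exact/esym/Am.
    rewrite -ge0_integralZr//.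
    + apply: eq_integral => y _; rewrite -EFinM; congr (_ * _)%:E.
      by rewrite !indicE; congr ((nat_of_bool _)%:R); apply/idP/idP; rewrite !inE xsectionE.
    + by apply/measurable_EFinP; apply: measurable_indic; exact: measurable_xsection.
    + by rewrite lee_fin sqr_ge0.
  rewrite mule0; apply/esym/integral0_eq => y _.
  rewrite indicE (_ : (_ \in _) = false) ?mul0r//.
  by apply/negP; rewrite inE => -[/= Dx _]; apply: xD; rewrite inE.
have pw z : \1_G z * f z.1 ^+ 2 <= rho * (k z + k' z) + 2 * B * t z.
  rewrite indicE; have [|_] := boolP (z \in G); last first.
    by rewrite mul0r addr_ge0// mulr_ge0// ?mulr_ge0// addr_ge0.
  rewrite inE => -[Dz Az]; rewrite mul1r.
  have tB : `|f z.1| * `|f z.2| <= B * t z.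
    rewrite /t mulrCA ler_wpM2l// mulrCA -[leLHS]mulr1 ler_wpM2l//.
    by rewrite expRN ler_pdivlMr ?expR_gt0// mul1r (VB _ _ Dz Az).
  have kd : (f z.1 - f z.2) ^+ 2 <= rho * (k z + k' z).
    (* On the diagonal the kernel carries no information, division by 0 giving 0; but there the two
       points coincide and the left-hand side vanishes. *)
    have [d0|dN0] := eqVneq (edist z.1 z.2) 0.
      by rewrite (edist_eq0 d0) subrr expr0n/= mulr_ge0// addr_ge0.
    have dp : 0 < edist z.1 z.2 `^ p by rewrite powR_gt0// lt0r dN0 sqrtr_ge0.
    have -> : (f z.1 - f z.2) ^+ 2 = k z * edist z.1 z.2 `^ p.
      by rewrite /k divfK ?gt_eqF// expr2.
    have -> : rho * (k z + k' z) = k z * (rho * (1 + expR (V z.1 - V z.2))).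
      by rewrite /k'; ring.
    by rewrite ler_wpM2l// dist.
  apply: (@le_trans _ _ ((f z.1 - f z.2) ^+ 2 + 2 * (`|f z.1| * `|f z.2|))).
    have : f z.1 * f z.2 <= `|f z.1| * `|f z.2| by rewrite -normrM ler_norm.
    by have := sqr_ge0 (f z.2); rewrite !expr2; lra.
  by rewrite lerD// -mulrA ler_wpM2l.
rewrite (@le_trans _ _ (\int[mu \x la]_z (rho * (k z + k' z) + 2 * B * t z)%:E)%E)//.
  apply: ge0_le_integral => //.
  - by move=> z _; rewrite lee_fin mulr_ge0 ?sqr_ge0// indicE.
  - exact/measurable_EFinP.
  - apply/measurable_EFinP; apply: measurable_funD.
      by apply: measurable_funM => //; exact: measurable_funD.
    exact: measurable_funM.
  - by move=> z _; rewrite lee_fin.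
have mkE : measurable_fun setT (fun z => (k z)%:E) by exact/measurable_EFinP.
have mkE' : measurable_fun setT (fun z => (k' z)%:E) by exact/measurable_EFinP.
have mtE : measurable_fun setT (fun z => (t z)%:E) by exact/measurable_EFinP.
rewrite (eq_integral (fun z => rho%:E * ((k z)%:E + (k' z)%:E) + (2 * B)%:E * (t z)%:E)%E);
  last by [].
have B20 : 0 <= 2 * B by rewrite mulr_ge0.
rewrite ge0_integralD//; last 4 first.
- by move=> z _; rewrite -EFinD -EFinM lee_fin mulr_ge0// addr_ge0.
- by apply: measurable_funeM; exact: emeasurable_funD.
- by move=> z _; rewrite -EFinM lee_fin mulr_ge0.
- exact: measurable_funeM.
rewrite !ge0_integralZl_EFin//; last 3 first.
- by move=> z _; rewrite lee_fin.
- by move=> z _; rewrite -EFinD lee_fin addr_ge0.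
- exact: emeasurable_funD.
rewrite ge0_integralD//; last 2 first.
- by move=> z _; rewrite lee_fin.
- by move=> z _; rewrite lee_fin.
rewrite Ek Ek' Et.
have E0 := dirichlet_form_ge0 alpha V f.
rewrite ge0_muleDr// -ge0_muleDl ?lee_fin//.
by rewrite -EFinD (_ : rho + rho = 2 * rho) ?mulr_natl// muleA -EFinM.
Qed.

End truncated_energy.

(** * Cubes *)

(** Cubes rather than Euclidean balls, since their Lebesgue measure is that of a product of
    intervals. *)
Definition cube {R : realType} d (x : euclidean R d) (s : R) : set (euclidean R d) :=
  [set y | forall i, `|tnth y i - tnth x i| <= s].

Lemma lebesgue_cube {R : realType} d (x : euclidean R d) (s : R) : 0 < s ->
  lebesgue_tuple d (cube x s) = ((2 * s) ^+ d)%:E.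
Proof.
move=> s0.
pose A (i : 'I_d) : set (measurableTypeR R) :=
  `[(tnth x i : R) - s, (tnth x i : R) + s]%classic.
have -> : cube x s = [set y | forall i, A i (tnth y i)].
  apply/seteqP; split => y yx i; have := yx i; rewrite /A /= in_itv/= ler_distl//.
have mA i : measurable (A i) by exact: measurable_itv.
apply: etrans (lebesgue_tuple_box mA) _.
rewrite (eq_bigr (fun=> (2 * s)%:E)); last first.
  move=> i _; rewrite lebesgue_measure_itv /= lte_fin ltrD2l gtrN// -EFinD.
  by congr EFin; ring.
by rewrite prodEFin prodr_const card_ord.
Qed.

Lemma measurable_cube_graph {R : realType} d (s : R) :
  measurable [set z : euclidean R d * euclidean R d | cube z.1 s z.2].
Proof.
rewrite (_ : [set _ | _] = \bigcap_(i in [set: 'I_d])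
    ((fun z : euclidean R d * euclidean R d => `|tnth z.2 i - tnth z.1 i|)
      @^-1` `]-oo, s]%classic)).
  apply: fin_bigcap_measurable => // i _; rewrite -[X in measurable X]setTI.
  suff : measurable_fun setT
      (fun z : euclidean R d * euclidean R d => `|(tnth z.2 i : R) - (tnth z.1 i : R)|).
    by move=> mi; apply: mi => //; exact: measurable_itv.
  apply: measurableT_comp => //; apply: measurable_funB.
    exact: (measurableT_comp (measurable_tnth_euclidean i) measurable_snd).
  exact: (measurableT_comp (measurable_tnth_euclidean i) measurable_fst).
apply/seteqP; split => z zs i; first by move=> _; rewrite /= in_itv/=; exact: zs.
by have := zs i I; rewrite /= in_itv.
Qed.

Lemma edist_cube_le {R : realType} d (x y : euclidean R d) (s : R) : 0 <= s ->
  cube x s y -> edist x y <= s * Num.sqrt d%:R.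
Proof.
move=> s0 xy; rewrite -[s]ger0_norm// -sqrtr_sqr -sqrtrM ?sqr_ge0//.
rewrite ler_sqrt ?mulr_ge0 ?sqr_ge0//.
have -> : s ^+ 2 * d%:R = \sum_(i < d) s ^+ 2 by rewrite sumr_const card_ord mulr_natr.
apply: ler_sum => i _.
by rewrite -[leLHS]real_normK ?num_real// ler_pXn2r ?nnegrE// distrC xy.
Qed.

Lemma edist_cube0_le {R : realType} d (x y : euclidean R d) (s : R) : 0 <= s ->
  cube [tuple 0 | _ < d] s y ->
  edist x y <= Num.sqrt (2 + 2 * d%:R * s ^+ 2) * (1 + enorm x).
Proof.
move=> s0 y0.
have e0 : 0 <= enorm x by exact: sqrtr_ge0.
rewrite -[1 + enorm x]ger0_norm ?addr_ge0// -sqrtr_sqr.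
have K0 : 0 <= 2 * d%:R * s ^+ 2 :> R by rewrite !mulr_ge0 ?sqr_ge0.
rewrite -sqrtrM ?addr_ge0// ler_sqrt ?mulr_ge0 ?addr_ge0 ?sqr_ge0//.
apply: (@le_trans _ _ (2 * enorm x ^+ 2 + 2 * d%:R * s ^+ 2)).
  rewrite sqr_sqrtr ?sumr_ge0// => [|i _]; last exact: sqr_ge0.
  have -> : 2 * d%:R * s ^+ 2 = \sum_(i < d) (2 * s ^+ 2).
    by rewrite sumr_const card_ord -mulr_natr; ring.
  rewrite mulr_sumr -big_split/=.
  apply: ler_sum => i _.
  have := y0 i; rewrite tnth_mktuple subr0 => yi.
  have : (tnth y i : R) ^+ 2 <= s ^+ 2.
    by rewrite -[leLHS]real_normK ?num_real// ler_pXn2r ?nnegrE.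
  have := sqr_ge0 ((tnth x i : R) + (tnth y i : R)).
  by rewrite !expr2; lra.
have : 0 <= 2 * d%:R * s ^+ 2 * (2 * enorm x + enorm x ^+ 2).
  by rewrite mulr_ge0// addr_ge0 ?mulr_ge0 ?exprn_ge0.
by rewrite expr2 in K0 *; nra.
Qed.

(** * The super Poincare inequality *)

Lemma divide_le_ereal {R : realType} (m a b : R) (X Y W : \bar R) : 0 < m ->
  0 <= a -> 0 <= b -> (m%:E * X <= a%:E * Y + b%:E * W)%E ->
  (0 <= Y)%E -> (0 <= W)%E ->
  (X <= (a / m)%:E * Y + (b / m)%:E * W)%E.
Proof.
move=> m0 a0 b0 H Y0 W0.
have mi0 : 0 <= m^-1 by rewrite invr_ge0 ltW.
have : (m^-1%:E * (m%:E * X) <= m^-1%:E * (a%:E * Y + b%:E * W))%E.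
  by rewrite lee_wpmul2l// lee_fin.
rewrite muleA -EFinM mulVf ?gt_eqF// mul1e ge0_muleDr ?mule_ge0 ?lee_fin//.
by rewrite !muleA -!EFinM ![m^-1 * _]mulrC.
Qed.

Section small_parameter.
Context {R : realType} (d : nat).
Variables (alpha : R) (V : {mfun euclidean R d >-> R}).
Local Notation T := (euclidean R d).
Local Notation la := (lebesgue_tuple d).
Local Notation mu := (gibbs V).
Local Notation p := (d%:R + alpha).
Local Notation q := (2 * (alpha + d%:R) / alpha).
Hypothesis d1 : (1 <= d)%N.
Hypothesis alpha02 : 0 < alpha < 2.
Variables (c s0 C0 : R).
Hypothesis c0 : 0 < c.
Hypothesis growth : forall x, c * (1 + enorm x) `^ p <= expR (V x / 2).
Hypothesis s0_gt0 : 0 < s0.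
Hypothesis oscillation : forall x y : T, cube x s0 y -> V y <= 5 / 4 * V x + C0.

Lemma super_poincare_small : exists a b : R, [/\ 0 <= a, 0 <= b &
  forall (r : R) (f : T -> R), 0 < r <= 1 -> measurable_fun setT f ->
  (\int[mu]_x (f x ^+ 2)%:E <=
    (a * r)%:E * dirichlet_form alpha V f f +
    (b * (1 + r `^ (- q)))%:E * (\int[mu]_x `|f x|%:E) ^+ 2)%E].
Proof.
have form_ge0 := dirichlet_form_ge0 alpha V.
have L1_ge0 (f : T -> R) : (0 <= (\int[mu]_x `|f x|%:E) ^+ 2)%E.
  by rewrite expe_ge0// integral_ge0.
(* [fine] sends +oo to 0 and 0^-1 is 0: a partition function equal to 0 or +oo gives the zero
   measure, for which the inequality is trivial. *)
have [Z0|ZN0] := eqVneq (fine (partition_function V)) 0.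
  have mu0 A : mu A = 0%E.
    transitivity ((fine (partition_function V))^-1%:E *
      \int[la]_(x in A) (expR (- V x))%:E)%E; first by [].
    by rewrite Z0 invr0 mul0e.
  exists 0, 0; split => // r f _ mf.
  rewrite [leLHS](eq_measure_integral mzero); last by move=> A _ _; exact: mu0.
  by rewrite integral_measure_zero !mul0r !mul0e adde0.
pose z0 := fine (partition_function V).
have Zge0 : (0 <= partition_function V)%E.
  by apply: integral_ge0 => x _; rewrite lee_fin expR_ge0.
have z0_gt0 : 0 < z0 by rewrite lt0r ZN0 fine_ge0.
have z0E : partition_function V = z0%:E.
  by rewrite /z0; move: ZN0; case: (partition_function V) => //=; rewrite eqxx.
have edist_ge0 (x y : T) : 0 <= edist x y by exact: sqrtr_ge0.
have [a0 a2] := andP alpha02.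
have dR : 1 <= d%:R :> R by rewrite ler1n.
have p0 : 0 < p by lra.
pose o : T := [tuple 0 | _ < d].
pose B2 := expR (5 / 4 * V o + C0).
pose K : R := Num.sqrt (2 + 2 * d%:R * s0 ^+ 2).
pose m2 := (2 * s0) ^+ d.
have m20 : 0 < m2 by rewrite exprn_gt0// mulr_gt0.
have B20 : 0 < B2 by exact: expR_gt0.
have K0 : 0 <= K by exact: sqrtr_ge0.
pose a := 2 * (s0 `^ alpha * Num.sqrt d%:R `^ p / 2 ^+ d + K `^ p / c * B2 / m2).
pose b := 2 * z0 * (expR C0 / m2 + B2 / m2).
exists a, b; split.
- by rewrite mulr_ge0// addr_ge0 ?mulr_ge0 ?invr_ge0 ?powR_ge0 ?(ltW c0) ?(ltW B20) ?(ltW m20) ?exprn_ge0.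
- by rewrite !mulr_ge0 ?(ltW z0_gt0)// addr_ge0// mulr_ge0 ?invr_ge0 ?expR_ge0 ?(ltW m20).
move=> r f /andP[r0 r1] mf.
pose L : R := - 2 * ln r.
have eL : expR (- L / 2) = r.
  by rewrite /L (_ : _ / 2 = ln r) ?lnK//; field.
pose D := [set x : T | V x <= L].
have mD : measurable D.
  rewrite (_ : D = V @^-1` `]-oo, L]%classic).
    rewrite -[X in measurable X]setTI; apply: (measurable_funP V) => //.
  by apply/seteqP; split => x; rewrite /D /= in_itv.
(* Then s^alpha = s0^alpha r, so [rho1 / m1], of order s^(p - d) = s^alpha, is a multiple of [r].
   Also [s <= s0] since [r <= 1], so the oscillation bound applies. *)
pose s := s0 * r `^ alpha^-1.
have s_gt0 : 0 < s by rewrite mulr_gt0// powR_gt0.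
have ss0 : s <= s0.
  rewrite ler_piMr ?(ltW s0_gt0)// -[leRHS](powRr0 r).
  by rewrite ger_powR ?r0// invr_ge0 ltW.
pose rho1 := (s * Num.sqrt d%:R) `^ p; pose m1 := (2 * s) ^+ d.
have m10 : 0 < m1 by rewrite exprn_gt0// mulr_gt0.
pose B1 := expR (5 / 4 * L + C0).
have piece1 : (m1%:E * \int[mu]_(x in D) (f x ^+ 2)%:E <=
    (2 * rho1)%:E * dirichlet_form alpha V f f +
    (2 * B1 * z0)%:E * (\int[mu]_x `|f x|%:E) ^+ 2)%E.
  apply: (truncated_energy z0_gt0 z0E mf (D := D) (A := fun x => cube x s)) => //.
  - exact: ltW.
  - exact: powR_ge0.
  - exact: expR_ge0.
  - rewrite (_ : [set _ | _] = D `*` setT `&` [set z | cube z.1 s z.2]).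
      by apply: measurableI; [exact: measurableX|exact: measurable_cube_graph].
    by apply/seteqP; split => z /= [Dz xz]; split => //; case: Dz.
  - by move=> x _; exact: lebesgue_cube.
  - move=> x y Dx xy; rewrite ler_expR (le_trans (oscillation (x := x) _))//.
      by move=> i; rewrite (le_trans (xy i)).
    by rewrite lerD2r; apply: ler_wpM2l Dx; lra.
  - move=> x y _ xy; apply: (@le_trans _ _ rho1).
      apply: ge0_ler_powR; rewrite ?nnegrE ?(ltW p0)//.
        by rewrite mulr_ge0 ?sqrtr_ge0 ?(ltW s_gt0).
      by rewrite edist_cube_le// ltW.
    by rewrite ler_peMr ?powR_ge0// lerDl expR_ge0.
pose rho2 := K `^ p / c * B2 * r.
have rho20 : 0 <= rho2.
  by rewrite !mulr_ge0 ?invr_ge0 ?powR_ge0 ?(ltW c0) ?(ltW B20) ?(ltW r0).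
have piece2 : (m2%:E * \int[mu]_(x in ~` D) (f x ^+ 2)%:E <=
    (2 * rho2)%:E * dirichlet_form alpha V f f +
    (2 * B2 * z0)%:E * (\int[mu]_x `|f x|%:E) ^+ 2)%E.
  have VB2 y : cube o s0 y -> expR (V y) <= B2 by move=> /oscillation; rewrite ler_expR.
  apply: (truncated_energy z0_gt0 z0E mf (D := ~` D) (A := fun _ => cube o s0)) => //.
  - exact: ltW.
  - exact: ltW.
  - exact: measurableC.
  - rewrite (_ : [set _ | _] = ~` D `*` cube o s0)//.
    apply: measurableX; first exact: measurableC.
    have := measurable_xsection o (@measurable_cube_graph R d s0).
    congr (measurable _); apply/seteqP; split => y; rewrite xsectionE //.
  - by move=> x _; exact: lebesgue_cube.
  - by move=> x y _; exact: VB2.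
  - move=> x y /= /negP; rewrite -ltNge => Lx oy.
    have e0 : 0 <= enorm x by exact: sqrtr_ge0.
    apply: (@le_trans _ _ ((K * (1 + enorm x)) `^ p)).
      apply: ge0_ler_powR; rewrite ?nnegrE ?(ltW p0)//.
        by rewrite mulr_ge0 ?addr_ge0.
      by rewrite edist_cube0_le// ltW.
    rewrite powRM ?addr_ge0//.
    have /(ler_wpM2l (powR_ge0 K p)) H : (1 + enorm x) `^ p <= expR (V x / 2) / c.
      by rewrite ler_pdivlMr// mulrC growth.
    apply: (le_trans H).
    (* Outside [D] the factor e^(-V(x)/2) is at most [r], while e^V(x) is at most B2 e^(V(x) -
       V(y)), the weight of the exchanged kernel. *)
    have -> : expR (V x / 2) = expR (V x) * expR (- (V x / 2)).
      by rewrite -expRD; congr expR; field.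
    have e2 : expR (- (V x / 2)) <= r.
      by rewrite -eL ler_expR mulNr lerN2 ler_pM2r// ltW.
    have e3 : expR (V x) <= B2 * expR (V x - V y).
      by rewrite expRD mulrCA ler_peMr ?expR_ge0// expRN ler_pdivlMr ?expR_gt0// mul1r VB2.
    apply: (@le_trans _ _ (K `^ p * (B2 * expR (V x - V y) * r / c))).
      rewrite ler_wpM2l ?powR_ge0// ler_wpM2r ?invr_ge0 ?(ltW c0)//.
      by rewrite ler_pM ?expR_ge0.
    have -> : K `^ p * (B2 * expR (V x - V y) * r / c) = rho2 * expR (V x - V y).
      by rewrite /rho2; ring.
    by rewrite ler_wpM2l// lerDr.
have splitD : (\int[mu]_x (f x ^+ 2)%:E =
    \int[mu]_(x in D) (f x ^+ 2)%:E + \int[mu]_(x in ~` D) (f x ^+ 2)%:E)%E.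
  rewrite -ge0_integral_setU//; first by rewrite setUv.
  - exact: measurableC.
  - by rewrite setUv; apply/measurable_EFinP; exact: measurable_funX.
  - by move=> x _; rewrite lee_fin sqr_ge0.
  - by apply/disj_setPCl.
have rho10 : 0 <= 2 * rho1 by rewrite mulr_ge0// powR_ge0.
have B1z0 : 0 <= 2 * B1 * z0 by rewrite !mulr_ge0 ?expR_ge0 ?(ltW z0_gt0).
have B2z0 : 0 <= 2 * B2 * z0 by rewrite !mulr_ge0 ?expR_ge0 ?(ltW z0_gt0).
have r20 : 0 <= 2 * rho2 by rewrite mulr_ge0.
have H1 := divide_le_ereal m10 rho10 B1z0 piece1 (form_ge0 f) (L1_ge0 f).
have H2 := divide_le_ereal m20 r20 B2z0 piece2 (form_ge0 f) (L1_ge0 f).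
rewrite splitD (le_trans (leeD H1 H2))// addeACA.
rewrite -!ge0_muleDl ?lee_fin ?divr_ge0 ?(ltW m10) ?(ltW m20)// -!EFinD.
rewrite leeD// lee_wpmul2r// lee_fin.
  have -> : 2 * rho1 / m1 = 2 * (s0 `^ alpha * Num.sqrt d%:R `^ p / 2 ^+ d) * r.
    have sp : s `^ p = s ^+ d * (s0 `^ alpha * r).
      rewrite powRD; last by rewrite gt_eqF// implybT.
      rewrite powR_mulrn ?(ltW s_gt0)// {2}/s powRM ?powR_ge0 ?(ltW s0_gt0)//.
      by rewrite -powRrM mulVf ?gt_eqF// powRr1// ltW.
    rewrite /rho1 powRM ?sqrtr_ge0 ?(ltW s_gt0)// sp /m1 [(2 * s) ^+ d]exprMn.
    by field; rewrite !expf_neq0// gt_eqF.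
  by rewrite /rho2 /a le_eqVlt; apply/orP; left; apply/eqP; ring.
have eL2 : expR (5 / 4 * L) = r `^ (- (5 / 2)).
  by rewrite /powR gt_eqF// /L; congr expR; field.
have sd : s ^+ d = s0 ^+ d * r `^ (d%:R / alpha).
  by rewrite /s exprMn -[(r `^ _) ^+ d]powR_mulrn ?powR_ge0// -powRrM [alpha^-1 * _]mulrC.
(* The exponent 5/2 comes from e^(5L/4), and d/alpha from the volume of the cube. Their sum is at
   most q = 2 + 2d/alpha as soon as d/alpha >= 1/2, which follows from d >= 1 and alpha < 2. *)
have rq : r `^ (- (5 / 2)) / r `^ (d%:R / alpha) <= r `^ (- q).
  rewrite -powRB; last by apply/implyP => _; rewrite gt_eqF.
  rewrite ger_powR ?r0//.
  have -> : - q = - 2 - 2 * (d%:R / alpha) by field; rewrite gt_eqF.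
  have : 1 / 2 <= d%:R / alpha by rewrite ler_pdivlMr//; lra.
  lra.
set X := r `^ (- q) in rq *.
have X0 : 0 <= X by exact: powR_ge0.
pose u := 2 * z0 * (expR C0 / m2).
have u0 : 0 <= u by rewrite !mulr_ge0 ?invr_ge0 ?expR_ge0 ?(ltW z0_gt0) ?(ltW m20).
have -> : 2 * B1 * z0 / m1 = u * (r `^ (- (5 / 2)) / r `^ (d%:R / alpha)).
  rewrite /B1 expRD eL2 /m1 [(2 * s) ^+ d]exprMn sd /u /m2 exprMn.
  by field; rewrite !expf_neq0 ?gt_eqF// powR_gt0.
have -> : 2 * B2 * z0 / m2 = 2 * z0 * (B2 / m2) by ring.
have v0 : 0 <= 2 * z0 * (B2 / m2).
  by rewrite !mulr_ge0 ?invr_ge0 ?(ltW B20) ?(ltW z0_gt0) ?(ltW m20).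
have -> : b * (1 + X) = u * (1 + X) + 2 * z0 * (B2 / m2) * (1 + X).
  by rewrite /b /u; ring.
rewrite lerD//; last by rewrite ler_peMr// lerDl.
by rewrite ler_wpM2l// (le_trans rq)// lerDr.
Qed.

(** Dividing [r] by [a'] absorbs the constant in front of the form, and capping at 1 covers large
    [r], where the constant term of the rate takes over. *)
Lemma super_poincare_of_growth : exists2 C : R, 0 < C &
  super_poincare alpha V (fun r => C * (1 + r `^ (- q))).
Proof.
have [a [b [a0 b0 sp]]] := super_poincare_small.
have [alpha0 _] := andP alpha02.
have q0 : 0 <= q by rewrite divr_ge0 ?mulr_ge0 ?addr_ge0 ?(ltW alpha0).
pose a' := a + 1; have a'0 : 0 < a' by rewrite ltr_wpDl.
exists ((b + 1) * (2 + a' `^ q)).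
  by apply: mulr_gt0; [exact: ltr_wpDl|apply: ltr_pwDl => //; exact: powR_ge0].
move=> r r0 f [f2 _].
have mf : measurable_fun setT f by move: f2; rewrite inE => /andP[]; rewrite inE.
pose r' := Num.min 1 (r / a').
have r'0 : 0 < r' by rewrite lt_min ltr01 divr_gt0.
have r'1 : r' <= 1 by rewrite ge_min lexx.
have := sp r' f; rewrite r'0 r'1 => /(_ isT mf) H; rewrite (le_trans H)//.
have form0 := dirichlet_form_ge0 alpha V f.
have L10 : (0 <= (\int[mu]_x `|f x|%:E) ^+ 2)%E.
  by rewrite expe_ge0// integral_ge0.
have ar : a * r' <= r.
  rewrite (@le_trans _ _ (a' * (r / a')))//.
    by rewrite ler_pM// ?(ltW r'0)// ?lerDl// ge_min lexx orbT.
  by rewrite mulrC divfK// gt_eqF.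
have br : r' `^ (- q) <= 1 + a' `^ q * r `^ (- q).
  rewrite /r'; case: (leP 1 (r / a')) => _.
    by rewrite powR1 lerDl mulr_ge0// powR_ge0.
  rewrite powRM ?invr_ge0 ?(ltW r0) ?(ltW a'0)//.
  by rewrite -[a'^-1]powR_inv1 ?(ltW a'0)// -powRrM mulN1r opprK mulrC lerDr.
apply: leeD; first by rewrite lee_wpmul2r// lee_fin.
rewrite lee_wpmul2r// lee_fin.
have H3 : 1 + r' `^ (- q) <= (2 + a' `^ q) * (1 + r `^ (- q)).
  have := powR_ge0 r (- q); have := powR_ge0 a' q; move: br.
  move: (r' `^ _) (r `^ _) (a' `^ _) => x y z xy z0 y0.
  by rewrite mulrDr mulr1; lra.
rewrite -[leRHS]mulrA; apply: ler_pM; [exact: b0| |by rewrite lerDl|exact: H3].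
by rewrite addr_ge0// powR_ge0.
Qed.

End small_parameter.

(** * The two potentials *)

Lemma super_poincare_le {R : realType} d (alpha : R) (V : {mfun euclidean R d >-> R})
    (b1 b2 : R -> R) : (forall r, 0 < r -> b1 r <= b2 r) ->
  super_poincare alpha V b1 -> super_poincare alpha V b2.
Proof.
move=> b12 sp r r0 f df; rewrite (le_trans (sp r r0 f df))// leeD2l//.
rewrite lee_wpmul2r// ?lee_fin ?b12//.
by rewrite expe_ge0// integral_ge0.
Qed.

(** Taking [g = f] in the relation between form and generator supplies the hypothesis of
    [opnorm_of_super_poincare]. The constant is fixed before the semigroup. *)
Lemma form_semigroup_opnorm {R : realType} d (alpha : R)
    (V : {mfun euclidean R d >-> R}) (C q : R) : 0 < C -> 0 < q ->
  super_poincare alpha V (fun r => C * (1 + r `^ (- q))) ->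
  exists2 C' : R, 0 < C' & forall P, form_semigroup alpha V P ->
    forall t, 0 < t -> (opnorm (gibbs V) 1 +oo (P t) <= (C' * (1 + t `^ (- q)))%:E)%E.
Proof.
move=> C0 q0 sp.
pose k := (2 `^ (- (q + 2))) `^ (- q) : R.
have k0 : 0 <= k by exact: powR_ge0.
exists (2 * C * (1 + k)); first by rewrite !mulr_gt0// ltr_pwDl.
move=> P [mP gP] t t0.
have H := @opnorm_of_super_poincare _ _ _ (gibbs V) C q (ltW C0) q0 P mP.
apply: le_trans (H _ t t0) _.
  move=> r f h r0 gfh.
  have [f2 h2 _] := gfh.
  have [df Ef] := (gP f h f2 h2).1 gfh.
  by have := sp r r0 f df; rewrite Ef.
rewrite lee_fin powRM ?powR_ge0 ?(ltW t0)// -/k.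
have := powR_ge0 t (- q); move: (t `^ _) => X X0.
rewrite -[leRHS]mulrA ler_wpM2l ?mulr_ge0 ?(ltW C0)//.
by rewrite mulrDl mul1r; have := mulr_ge0 k0 X0; lra.
Qed.

(** Young's inequality with a = b - 1 gives y_i^2 <= b x_i^2 + (b/a)(y_i - x_i)^2. The radius is
    small enough for the error terms to sum to at most a, so that 1 + a = b closes the estimate. *)
Lemma cube_enorm_le {R : realType} d (b : R) : (1 <= d)%N -> 1 < b ->
  exists2 s : R, 0 < s & forall x y : euclidean R d, cube x s y ->
    1 + enorm y ^+ 2 <= b * (1 + enorm x ^+ 2).
Proof.
move=> d1 b1; pose a := b - 1.
have a0 : 0 < a by rewrite subr_gt0.
have dR : 1 <= d%:R :> R by rewrite ler1n.
have d0 : 0 < d%:R :> R by rewrite (lt_le_trans ltr01).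
pose s := a / (b * d%:R).
have b0 : 0 < b by rewrite (lt_trans ltr01).
have s0 : 0 < s by rewrite divr_gt0// mulr_gt0.
have enorm2 (x : euclidean R d) : enorm x ^+ 2 = \sum_(i < d) (tnth x i : R) ^+ 2.
  by rewrite sqr_sqrtr// sumr_ge0// => i _; exact: sqr_ge0.
exists s => // x y xy; rewrite !enorm2.
have : \sum_(i < d) (tnth y i : R) ^+ 2 <=
    \sum_(i < d) (b * (tnth x i : R) ^+ 2 + b / a * s ^+ 2).
  apply: ler_sum => i _; have := xy i.
  move: (tnth x i : R) (tnth y i : R) => u v uv.
  have e2 : (v - u) ^+ 2 <= s ^+ 2.
    by rewrite -[leLHS]real_normK ?num_real// ler_pXn2r ?nnegrE// ltW.
  have : 0 <= (a * u - (v - u)) ^+ 2 / a by rewrite divr_ge0 ?sqr_ge0// ltW.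
  have -> : (a * u - (v - u)) ^+ 2 / a = b * u ^+ 2 + b / a * (v - u) ^+ 2 - v ^+ 2.
    by rewrite /a; field; rewrite gt_eqF.
  have := ler_wpM2l (ltW (divr_gt0 b0 a0)) e2.
  lra.
rewrite big_split/= -mulr_sumr sumr_const card_ord.
have : (b / a * s ^+ 2) *+ d <= a.
  rewrite -mulr_natr (_ : _ * _ = a / (b * d%:R)); last first.
    by rewrite /s; field; rewrite !gt_eqF.
  rewrite ler_pdivrMr ?mulr_gt0// ler_peMr ?(ltW a0)//.
  by apply: mulr_ege1 => //; exact: ltW.
by rewrite /a mulrDr mulr1; lra.
Qed.

(** From (1 + |x|)^2 <= 2 (1 + |x|^2), by exponentiating half of the logarithmic lower bound on
    [v]. *)
Lemma enorm_growth {R : realType} d (p K : R) (v : euclidean R d -> R) : 0 < p ->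
  (forall x, p * ln (1 + enorm x ^+ 2) <= v x + K) ->
  exists2 c : R, 0 < c & forall x, c * (1 + enorm x) `^ p <= expR (v x / 2).
Proof.
move=> p0 vK.
have cN0 : 0 < 2 `^ (p / 2) * expR (K / 2) :> R by rewrite mulr_gt0 ?powR_gt0 ?expR_gt0.
exists (2 `^ (p / 2) * expR (K / 2))^-1; first by rewrite invr_gt0.
move=> x; rewrite ler_pdivrMl// -mulrA -expRD.
have e0 : 0 <= enorm x by exact: sqrtr_ge0.
have N0 : 0 < 1 + enorm x ^+ 2 by rewrite ltr_pwDl// sqr_ge0.
have -> : (1 + enorm x) `^ p = ((1 + enorm x) ^+ 2) `^ (p / 2).
  rewrite -[(1 + enorm x) ^+ 2]powR_mulrn ?addr_ge0// -powRrM.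
  by congr (_ `^ _); field.
apply: (@le_trans _ _ ((2 * (1 + enorm x ^+ 2)) `^ (p / 2))).
  apply: ge0_ler_powR; rewrite ?nnegrE ?divr_ge0 ?sqr_ge0 ?(ltW p0)//.
    by rewrite mulr_ge0 ?(ltW N0).
  by have := sqr_ge0 (1 - enorm x); rewrite !expr2; lra.
rewrite powRM ?(ltW N0)// ler_wpM2l ?powR_ge0//.
rewrite /powR gt_eqF// ler_expR; have := vK x; lra.
Qed.

(** With u = ln(1 + |x|^2), the threshold p^(1/eps) is where u^eps = p: beyond it u^(1 + eps) >= p
    u, and below it p u is at most the constant. *)
Lemma log_potential_ge {R : realType} d (eps p : R) : 0 < eps -> 0 < p ->
  exists K, forall x : euclidean R d,
    p * ln (1 + enorm x ^+ 2) <= log_potential eps x + K.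
Proof.
move=> eps0 p0; exists (p * p `^ eps^-1) => x.
rewrite /log_potential; set u := ln _.
have u0 : 0 <= u by rewrite ln_ge0// lerDl sqr_ge0.
have K0 : 0 <= p * p `^ eps^-1 by rewrite mulr_ge0 ?powR_ge0// ltW.
have [up|pu] := leP u (p `^ eps^-1).
  rewrite (@le_trans _ _ (p * p `^ eps^-1))//; first by rewrite ler_wpM2l// ltW.
  by rewrite lerDr powR_ge0.
rewrite (@le_trans _ _ (u `^ (1 + eps)))//; last by rewrite lerDl.
have u_gt0 : 0 < u by rewrite (le_lt_trans _ pu)// powR_ge0.
rewrite powRD; last by apply/implyP => _; rewrite gt_eqF.
rewrite powRr1// mulrC ler_wpM2l//.
rewrite -[leLHS](powRr1 (ltW p0)) -(mulVf (lt0r_neq0 eps0)) powRrM.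
by apply: ge0_ler_powR; rewrite ?nnegrE ?powR_ge0 ?(ltW eps0) ?(ltW pu).
Qed.

(** A factor e^a on 1 + |x|^2 adds a to its logarithm u, and a + u <= (1 + a) max(1, u), where a is
    chosen so that (1 + a)^(1 + eps) = 5/4. The additive constant 5/4 covers u <= 1. *)
Lemma log_potential_oscillation {R : realType} d (eps : R) : (1 <= d)%N -> 0 < eps ->
  exists s0 K : R, 0 < s0 /\ forall x y : euclidean R d, cube x s0 y ->
    log_potential eps y <= 5 / 4 * log_potential eps x + K.
Proof.
move=> d1 eps0; have e1 : 0 < 1 + eps by lra.
have l1 : 1 < (5 / 4) `^ (1 + eps)^-1 :> R.
  have := @gt0_ltr_powR R (1 + eps)^-1.
  rewrite invr_gt0 => /(_ e1 1 (5 / 4)); rewrite powR1; apply; rewrite ?nnegrE; lra.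
pose a : R := (5 / 4) `^ (1 + eps)^-1 - 1.
have a0 : 0 < a by rewrite subr_gt0.
have ea1 : 1 < expR a by rewrite expR_gt1.
have [s s0 sP] := cube_enorm_le d1 ea1.
exists s, (5 / 4); split => // x y /sP xy.
rewrite /log_potential; set u := ln (1 + enorm x ^+ 2).
have Nx : 1 <= 1 + enorm x ^+ 2 by rewrite lerDl sqr_ge0.
have Ny : 1 <= 1 + enorm y ^+ 2 by rewrite lerDl sqr_ge0.
have u0 : 0 <= u by rewrite ln_ge0.
have au : ln (1 + enorm y ^+ 2) <= a + u.
  rewrite -[a]expRK -lnM ?posrE ?expR_gt0 ?(lt_le_trans ltr01 Nx)//.
  by rewrite ler_ln ?posrE ?mulr_gt0 ?expR_gt0 ?(lt_le_trans ltr01 Nx) ?(lt_le_trans ltr01 Ny).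
have au1 : ln (1 + enorm y ^+ 2) `^ (1 + eps) <= ((1 + a) * Num.max 1 u) `^ (1 + eps).
  apply: ge0_ler_powR; rewrite ?nnegrE ?(ltW e1) ?ln_ge0//.
    by apply: mulr_ge0; [rewrite addr_ge0 ?(ltW a0)|rewrite le_max ler01].
  have uM : u <= Num.max 1 u by rewrite le_max lexx orbT.
  have : a <= a * Num.max 1 u by rewrite ler_peMr ?(ltW a0)// le_max lexx.
  by move: (Num.max 1 u) uM => M uM aM; rewrite mulrDl mul1r; lra.
have a54 : (1 + a) `^ (1 + eps) = 5 / 4.
  rewrite /a addrC subrK -powRrM mulVf ?gt_eqF// powRr1//; lra.
have a1 : 0 <= 1 + a by rewrite addr_ge0// ltW.
have M0 : 0 <= Num.max 1 u by rewrite le_max ler01.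
apply: (le_trans au1); rewrite powRM// a54.
have := powR_ge0 u (1 + eps).
by case: (leP 1 u) => _; rewrite ?powR1; move: (u `^ _) => w w0; clear -w0; lra.
Qed.

(** With u = ln(1 + |x|^2), e^(eps u) >= (eps u / 2)^2, and completing the square bounds this below
    by p u - p^2 / eps^2. *)
Lemma power_potential_ge {R : realType} d (eps p : R) : 0 < eps -> 0 < p ->
  exists K, forall x : euclidean R d,
    p * ln (1 + enorm x ^+ 2) <= power_potential eps x + K.
Proof.
move=> eps0 p0; exists (p ^+ 2 / eps ^+ 2) => x.
have N0 : 0 < 1 + enorm x ^+ 2 by rewrite ltr_pwDl// sqr_ge0.
rewrite /power_potential /powR gt_eqF//; set u := ln _.
have u0 : 0 <= u by rewrite ln_ge0// lerDl sqr_ge0.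
have h0 : 0 <= eps * u / 2 by rewrite divr_ge0// mulr_ge0// ltW.
have -> : expR (eps * u) = expR (eps * u / 2) ^+ 2.
  by rewrite expr2 -expRD -splitr.
have e1 : (eps * u / 2) ^+ 2 <= expR (eps * u / 2) ^+ 2.
  rewrite ler_pXn2r ?nnegrE ?expR_ge0//.
  by rewrite (le_trans _ (expR_ge1Dx _))// lerDr.
have : 0 <= (eps * u / 2 - p / eps) ^+ 2 by exact: sqr_ge0.
have -> : (eps * u / 2 - p / eps) ^+ 2 =
    (eps * u / 2) ^+ 2 + p ^+ 2 / eps ^+ 2 - p * u by field; rewrite gt_eqF.
by move: e1; lra.
Qed.

(** A factor (5/4)^(1/eps) on 1 + |x|^2 becomes exactly 5/4 after the power [eps]. *)
Lemma power_potential_oscillation {R : realType} d (eps : R) : (1 <= d)%N -> 0 < eps ->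
  exists s0 K : R, 0 < s0 /\ forall x y : euclidean R d, cube x s0 y ->
    power_potential eps y <= 5 / 4 * power_potential eps x + K.
Proof.
move=> d1 eps0.
have b1 : 1 < (5 / 4) `^ eps^-1 :> R.
  have := @gt0_ltr_powR R eps^-1.
  rewrite invr_gt0 => /(_ eps0 1 (5 / 4)); rewrite powR1; apply; rewrite ?nnegrE; lra.
have [s s0 sP] := @cube_enorm_le R d _ d1 b1.
exists s, 0; split => // x y /sP xy.
have N0 (z : euclidean R d) : 0 <= 1 + enorm z ^+ 2 by rewrite addr_ge0 ?sqr_ge0.
rewrite addr0 /power_potential.
have -> : 5 / 4 = (5 / 4) `^ eps^-1 `^ eps :> R.
  by rewrite -powRrM mulVf ?gt_eqF// powRr1//; lra.
rewrite -powRM ?powR_ge0//.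
apply: ge0_ler_powR; rewrite ?nnegrE ?(ltW eps0) ?mulr_ge0 ?powR_ge0//.
Qed.

Lemma log_rate_ge {R : realType} d (alpha eps C r : R) : 0 <= C ->
  C * (1 + r `^ (- (2 * (alpha + d%:R) / alpha))) <= log_rate d alpha eps C r.
Proof.
move=> C0; rewrite /log_rate mulrDr mulr1 lerD2l ler_peMr ?mulr_ge0 ?powR_ge0//.
by rewrite -expR0 ler_expR mulr_ge0// powR_ge0.
Qed.

(** The logarithmic factor tends to 0 as [r] grows, unlike the exponential one of [log_rate]. For r
    <= 1 it is at least (ln 2)^e; for r > 1 the power of [r] is at most 1 and the constant term
    suffices. *)
Lemma power_rate_ge {R : realType} d (alpha eps C : R) : 0 < alpha -> 0 < eps ->
  0 < C -> exists2 C' : R, 0 < C' & forall r, 0 < r ->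
  C * (1 + r `^ (- (2 * (alpha + d%:R) / alpha))) <= power_rate d alpha eps C' r.
Proof.
move=> a0 e0 C0; rewrite /power_rate.
set e := (2 * alpha + d%:R) * (d%:R + alpha) / (2 * eps * alpha).
set q := 2 * (alpha + d%:R) / alpha.
have e_ge0 : 0 <= e.
  by rewrite divr_ge0 ?mulr_ge0 ?addr_ge0 ?mulr_ge0 ?(ltW a0) ?(ltW e0).
have q0 : 0 <= q by rewrite divr_ge0 ?mulr_ge0 ?addr_ge0 ?(ltW a0).
have ln2 : 0 < ln 2 :> R by rewrite ln_gt0// ltr1n.
pose k : R := ln 2 `^ e; have k0 : 0 < k by rewrite powR_gt0.
have ki0 : 0 < k^-1 by rewrite invr_gt0.
exists (C * (2 + k^-1)); first by rewrite mulr_gt0// addr_gt0.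
move=> r r0; rewrite -[leRHS]mulrA ler_wpM2l ?(ltW C0)//.
have X0 := powR_ge0 r (- q); have Y0 := powR_ge0 (ln (1 + r^-1)) e.
have [r1|r1] := leP r 1; last first.
  have X1 : r `^ (- q) <= 1 by rewrite -(powRr0 r) ler_powR ?(ltW r1)// oppr_le0.
  have := mulr_ge0 X0 Y0; move: (r `^ _) (_ `^ e) X1 => X Y X1 XY0.
  by have := mulr_ge0 (ltW ki0) XY0; rewrite mulrDr mulr1 mulrDl; lra.
have kY : k <= ln (1 + r^-1) `^ e.
  apply: ge0_ler_powR; rewrite ?nnegrE ?(ltW ln2) ?ln_ge0 ?lerDl ?invr_ge0 ?(ltW r0)//.
  rewrite ler_ln ?posrE ?ltr_pwDl ?invr_ge0 ?(ltW r0)//.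
  by rewrite -[2]/(1 + 1 : R) lerD2l invf_ge1.
move: (r `^ _) (_ `^ e) X0 Y0 kY => X Y X0 Y0 kY.
have : 1 <= k^-1 * Y by rewrite -(mulVf (lt0r_neq0 k0)) ler_wpM2l// ltW.
move=> /(ler_wpM2l X0); rewrite mulr1 => H.
have := mulr_ge0 X0 Y0.
have -> : (2 + k^-1) * (1 + X * Y) = 2 + k^-1 + 2 * (X * Y) + X * (k^-1 * Y) by ring.
lra.
Qed.

(** * Super Poincare inequalities for both potentials, and the comparison with the stated rates *)

Section conclusion.
Context {R : realType} (d : nat) (alpha eps : R).
Hypothesis hd : (1 <= d)%N.
Hypothesis halpha : 0 < alpha < 2.
Hypothesis heps : 0 < eps.
Local Notation q := (2 * (alpha + d%:R) / alpha).

Let p_gt0 : 0 < d%:R + alpha.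
Proof. by have /andP[a0 _] := halpha; rewrite ltr_wpDl. Qed.

Lemma log_potential_super_poincare : exists2 C : R, 0 < C &
  super_poincare alpha (@log_potential R d eps) (fun r => C * (1 + r `^ (- q))).
Proof.
have [K /(enorm_growth p_gt0) [c c0 growth]] := log_potential_ge d heps p_gt0.
have [s0 [K' [s0_gt0 osc]]] := log_potential_oscillation hd heps.
exact: super_poincare_of_growth c0 growth s0_gt0 osc.
Qed.

Lemma power_potential_super_poincare : exists2 C : R, 0 < C &
  super_poincare alpha (@power_potential R d eps) (fun r => C * (1 + r `^ (- q))).
Proof.
have [K /(enorm_growth p_gt0) [c c0 growth]] := power_potential_ge d heps p_gt0.
have [s0 [K' [s0_gt0 osc]]] := power_potential_oscillation hd heps.
exact: super_poincare_of_growth c0 growth s0_gt0 osc.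
Qed.

End conclusion.

Theorem corollary1p5 (R : realType) (d : nat) (alpha eps : R)
    (hd : (1 <= d)%N) (halpha : 0 < alpha < 2) (heps : 0 < eps) :
  ((exists2 c : R, 0 < c &
      super_poincare alpha (@log_potential R d eps) (log_rate d alpha eps c)) /\
   (exists2 lambda : R, 0 < lambda &
      forall P, form_semigroup alpha (@log_potential R d eps) P ->
      forall t : R, 0 < t ->
        (opnorm (gibbs (@log_potential R d eps)) 1 +oo (P t)
          <= (log_rate d alpha eps lambda t)%:E)%E)) /\
  ((exists2 c : R, 0 < c &
      super_poincare alpha (@power_potential R d eps)
        (power_rate d alpha eps c)) /\
   (exists2 lambda : R, 0 < lambda &
      forall P, form_semigroup alpha (@power_potential R d eps) P ->
      forall t : R, 0 < t ->
        (opnorm (gibbs (@power_potential R d eps)) 1 +oo (P t)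
          <= (power_rate d alpha eps lambda t)%:E)%E)).
Proof.
have /andP[a0 _] := halpha.
have q0 : 0 < 2 * (alpha + d%:R) / alpha by rewrite divr_gt0 ?mulr_gt0 ?ltr_pwDl.
split.
- have [C C0 sp] := log_potential_super_poincare hd halpha heps.
  have [C' C'0 op] := form_semigroup_opnorm C0 q0 sp.
  split.
    by exists C => //; apply: super_poincare_le sp => r _; apply: log_rate_ge; exact: ltW.
  exists C' => // P HP t t0; rewrite (le_trans (op P HP t t0))// lee_fin.
  by apply: log_rate_ge; exact: ltW.
- have [C C0 sp] := power_potential_super_poincare hd halpha heps.
  have [C' C'0 op] := form_semigroup_opnorm C0 q0 sp.
  split.
    have [c c0 cP] := power_rate_ge d a0 heps C0.
    by exists c => //; exact: super_poincare_le cP sp.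
  have [c c0 cP] := power_rate_ge d a0 heps C'0.
  exists c => // P HP t t0; rewrite (le_trans (op P HP t t0))// lee_fin.
  exact: cP.
Qed.
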